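(* Let $n\ge2$ be a natural number. For all $s\in\,]1,n[$ there exists a proper $n$-quasi-copula $Q$ whose support $\mathrm{supp}(Q)$ is a self-similar set and has dimension $s$, i.e. $\dim_{\mathcal{H}}(\mathrm{supp}(Q))=\dim_{\mathcal{B}}(\mathrm{supp}(Q))=s$.
   Context: An $n$-quasi-copula is a function $Q\colon[0,1]^n\to[0,1]$ such that: $Q(\mathbf{u})=0$ if at least one coordinate of $\mathbf{u}$ is $0$, and $Q(\mathbf{u})=u_k$ whenever all coordinates of $\mathbf{u}$ are $1$ except, maybe, $u_k$; $Q$ is non-decreasing in each variable; and $|Q(\mathbf{u})-Q(\mathbf{v})|\le\sum_{i=1}^n|u_i-v_i|$ for all $\mathbf{u},\mathbf{v}\in[0,1]^n$. For an $n$-box $B=[a_1,b_1]\times\cdots\times[a_n,b_n]\subseteq[0,1]^n$ with $a_i\le b_i$, the $Q$-volume is $V_Q(B)=\sum_{J\subseteq\{1,\ldots,n\}}(-1)^{|J|}Q(\mathbf{c}^J)$, where $c^J_i=a_i$ if $i\in J$ and $c^J_i=b_i$ otherwise. An $n$-copula is an $n$-quasi-copula with $V_Q(B)\ge0$ for every such $B$; an $n$-quasi-copula is proper if it is not an $n$-copula. Support: a box $R=I_1\times\cdots\times I_n$, where each $I_k$ is an open interval in $[0,1]$ (open in the relative topology of $[0,1]$), is open $Q$-null if $V_Q(B)=0$ for every closed $n$-box $B=[a_1,b_1]\times\cdots\times[a_n,b_n]\subset R$. $\mathrm{supp}(Q)$ is the complement in $[0,1]^n$ of the union of all open $Q$-null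 boxes. A similarity with ratio $c\in\,]0,1[$ is a map $S$ with $d(S(x),S(y))=c\,d(x,y)$ for all $x,y$. A set $E$ is self-similar if $E=\bigcup_{k=1}^m S_k(E)$ for some similarities $S_1,\ldots,S_m$. $\dim_{\mathcal{H}}$ is the Hausdorff dimension; $\dim_{\mathcal{B}}(E)=-\lim_{\delta\to0}\frac{\ln N_\delta(E)}{\ln\delta}$ is the box-counting dimension, where $N_\delta(E)$ is the smallest number of sets of diameter at most $\delta$ that cover $E$. *)

(* Defs.v *)
From HB Require Import structures.
From mathcomp Require Import all_boot all_order all_algebra.
From mathcomp Require Import all_classical all_reals all_analysis.

Set Implicit Arguments.
Unset Strict Implicit.
Unset Printing Implicit Defensive.

Import Order.TTheory GRing.Theory Num.Theory.
Import numFieldNormedType.Exports.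

Local Open Scope classical_set_scope.
Local Open Scope ring_scope.

(* Points of R^n are row vectors. *)

Section QuasiCopulas.
Context {R : realType} {n : nat}.
Implicit Types (Q : 'rV[R]_n -> R) (a b u v x : 'rV[R]_n).

Definition closed_box a b : set 'rV[R]_n :=
  [set x | forall i, a 0 i <= x 0 i <= b 0 i].

Definition unit_cube : set 'rV[R]_n :=
  [set x | forall i, 0 <= x 0 i <= 1].

(* Q is a total function on R^n, but only its values on the unit cube are
   ever constrained or used. *)
Definition quasi_copula Q : Prop :=
  [/\ forall u, unit_cube u -> 0 <= Q u <= 1,
      forall u, unit_cube u -> (exists i, u 0 i = 0) -> Q u = 0,
      forall u k, unit_cube u -> (forall i, i != k -> u 0 i = 1) ->
        Q u = u 0 k,
      forall u v k, unit_cube u -> unit_cube v ->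
        (forall i, i != k -> u 0 i = v 0 i) -> u 0 k <= v 0 k -> Q u <= Q v
    & forall u v, unit_cube u -> unit_cube v ->
        `|Q u - Q v| <= \sum_i `|u 0 i - v 0 i|].

Definition volume Q a b : R :=
  \sum_(J : {set 'I_n})
    (-1) ^+ #|J| * Q (\row_i (if i \in J then a 0 i else b 0 i)).

Definition copula Q : Prop :=
  quasi_copula Q /\
  forall a b, (forall i, a 0 i <= b 0 i) -> closed_box a b `<=` unit_cube ->
    0 <= volume Q a b.

Definition proper_quasi_copula Q : Prop := quasi_copula Q /\ ~ copula Q.

(* An interval contained in [0, 1] and open for its relative topology. *)
Definition open_interval01 (I : set R) : Prop :=
  is_interval I /\ exists U : set R, open U /\ I = U `&` `[0, 1].

Definition box (I : 'I_n -> set R) : set 'rV[R]_n :=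
  [set x | forall i, I i (x 0 i)].

Definition open_null_box Q (B : set 'rV[R]_n) : Prop :=
  exists I : 'I_n -> set R,
    [/\ forall i, open_interval01 (I i), B = box I
      & forall a b, (forall i, a 0 i <= b 0 i) -> closed_box a b `<=` B ->
          volume Q a b = 0].

Definition supp Q : set 'rV[R]_n :=
  unit_cube `\` \bigcup_(B in open_null_box Q) B.

End QuasiCopulas.

Section FractalGeometry.
Context {R : realType} {n : nat}.
Implicit Types (E U : set 'rV[R]_n) (x y : 'rV[R]_n).

(* The library norm on row vectors is the sup norm, hence this definition. *)
Definition edist x y : R := Num.sqrt (\sum_i (x 0 i - y 0 i) ^+ 2).

Definition similarity (c : R) (S : 'rV[R]_n -> 'rV[R]_n) : Prop :=
  0 < c < 1 /\ forall x y, edist (S x) (S y) = c * edist x y.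

Definition self_similar E : Prop :=
  exists (m : nat) (S : 'I_m -> 'rV[R]_n -> 'rV[R]_n),
    (forall k, exists c, similarity c (S k)) /\
    E = \bigcup_k (S k @` E).

Local Open Scope ereal_scope.

(* Adjoining 0 makes the diameter of the empty set 0 instead of -oo. *)
Definition diam U : \bar R :=
  ereal_sup (0 |` [set (edist x y)%:E | x in U & y in U]).

(* The convention is that the empty set contributes 0 even when t = 0. *)
Definition diam_pow (t : R) U : \bar R :=
  if U == set0 then 0 else diam U `^ t.

Definition hausdorff_premeasure (t delta : R) E : \bar R :=
  ereal_inf [set \sum_(0 <= k <oo) diam_pow t (U k) | U in
    [set U : (set 'rV[R]_n)^nat |
      (forall k, diam (U k) <= delta%:E) /\ E `<=` \bigcup_k U k]].

(* As the premeasure is nonincreasing in delta, this supremum is its limit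
   when delta tends to 0. *)
Definition hausdorff_measure (t : R) E : \bar R :=
  ereal_sup [set hausdorff_premeasure t delta E |
    delta in [set delta : R | (0 < delta)%R]].

Definition hausdorff_dim E : \bar R :=
  ereal_inf [set t%:E | t in
    [set t : R | (0 <= t)%R /\ hausdorff_measure t E = 0]].

(* +oo when no finite cover exists. *)
Definition covering_number (delta : R) E : \bar R :=
  ereal_inf [set m%:R%:E | m in
    [set m : nat | exists U : 'I_m -> set 'rV[R]_n,
      (forall k, diam (U k) <= delta%:E) /\ E `<=` \bigcup_k U k]].

(* The limit defining the box-counting dimension exists and equals d. *)
Definition has_box_dim E (d : \bar R) : Prop :=
  - (lne (covering_number delta E) / (ln delta)%:E) @[delta --> 0%R^'+] --> d.

End FractalGeometry.

(* Main.v *)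
Require Import Defs.
From mathcomp Require Import all_boot all_order all_algebra.
From mathcomp Require Import all_classical all_reals all_analysis.
From mathcomp Require Import ring lra.

Set Implicit Arguments.
Unset Strict Implicit.
Unset Printing Implicit Defensive.

Import Order.TTheory GRing.Theory Num.Theory.
Import numFieldNormedType.Exports.
Local Open Scope classical_set_scope.
Local Open Scope ring_scope.

(** The support is the attractor of a system of similarities that maps the unit
    cube onto the [3 ^ n] cubes of side [r] filling [[0, 3 r]^n] and onto the
    cube [[3 r, 1]^n]. Moran's equation [3 ^ n * r ^ s + (1 - 3 r) ^ s = 1] for
    its dimension has a solution [r] exactly because [1 < s < n]
    ([side_length_exists]).

    Assign a weight to each cube of the system, and let [transform] send a
    function [f] to the weighted sum of its copies in these cubes. If the
    weights in each slab add up to its width, uniform margins are preserved. For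
    the positive weights that spread the mass of each slab of width [r] evenly,
    [transform] has a fixed point [C], the limit of the iterates starting at the
    upper Frechet-Hoeffding bound ([transform_fixed_point]); it behaves like a
    copula. The quasi-copula is obtained from [C] by one more transformation,
    with weights of the same margins that are negative on some of the small
    cubes. It is not a copula as these cubes form a box of negative
    volume ([signed_not_copula]); it is still monotone and Lipschitz, because
    [C] is supermodular, so that in each slab the increment coming from a
    negative cube is outweighed by that of a neighbouring positive cube
    ([tame_increments_signed]).

    The support of a transformed function is the union of the copies of the
    original support, whatever the signs of the nonzero weights
    ([supp_transform]). Applied to the positive weights, this says that the
    support [E] of [C] is self-similar; applied to the signed ones, that the
    quasi-copula has the same support [E].

    For the dimensions, the self-similarity of [E] yields covers by O(d^-s) sets
    of diameter [d] ([upper_regular_self_similar]), which bounds both dimensions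
    above by [s]. Conversely the mass distribution principle bounds the sum of
    the [diam U ^ s] over any cover from below
    ([content_positive_self_similar]). The mass used there is not that of [C]
    but the one giving weight [rho ^ s] to a cube of side [rho]; as [E] is
    compact, discrete approximations of it suffice. *)

(** * Real powers *)

Section RealPowers.
Context {R : realType}.
Implicit Types (s t a b x q d : R).

Lemma finite_lower_bound (I : finType) (F : I -> R) :
  (forall i, 0 < F i) -> exists2 e, 0 < e & forall i, e <= F i.
Proof.
move=> F0; exists (\big[Num.min/1]_i F i); first by apply/lt_bigmin.
by move=> i; exact: bigmin_le.
Qed.

Lemma exists_exp_le (q d : R) : 0 < q < 1 -> 0 < d -> exists k, q ^+ k <= d.
Proof.
move=> /andP[q0 q1] d0.
have : `|q| < 1 by rewrite ger0_norm// ltW.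
move=> /cvg_expr/cvgrPdist_le/(_ d d0)[k _ /(_ k (leqnn k))/=].
by rewrite sub0r normrN ger0_norm ?exprn_ge0 ?(ltW q0)// => kd; exists k.
Qed.

Lemma le_powR s a b : 0 <= s -> 0 <= a -> a <= b -> a `^ s <= b `^ s.
Proof.
by move=> s0 a0 ab; apply: ge0_ler_powR => //; rewrite nnegrE// (le_trans a0).
Qed.

Lemma one_le_powR a t : 1 <= a -> 0 <= t -> 1 <= a `^ t.
Proof. by move=> a1 t0; rewrite -[leLHS](powRr0 a) ler_powR. Qed.

Lemma powR_add_le s (a b : R) : 0 <= s -> 0 <= a -> 0 <= b ->
  (a + b) `^ s <= 2 `^ s * (a `^ s + b `^ s).
Proof.
move=> s_ge0 a0 b0; apply: (@le_trans _ _ ((2 * Num.max a b) `^ s)).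
  apply: le_powR => //; first exact: addr_ge0.
  have : a <= Num.max a b by rewrite le_max lexx.
  have : b <= Num.max a b by rewrite le_max lexx orbT.
  lra.
rewrite powRM ?le_max ?a0// ler_wpM2l ?powR_ge0//.
by case: (leP a b) => _; rewrite ?lerDl ?lerDr powR_ge0.
Qed.

Lemma continuous_powR (s x : R) : 0 < x -> {for x, continuous (fun y => y `^ s)}.
Proof.
move=> x0; apply: differentiable_continuous; apply/derivable1_diffP.
by apply: derivable_powR; rewrite in_itv/= x0.
Qed.

End RealPowers.

(** * Volumes and supports *)

Section Clamp.
Context {R : realType}.
Implicit Types x y : R.

Definition clamp x : R := Num.max 0 (Num.min 1 x).

Lemma clamp_ge0 x : 0 <= clamp x.
Proof. by rewrite /clamp le_max lexx. Qed.

Lemma clamp_le1 x : clamp x <= 1.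
Proof. by rewrite /clamp ge_max ler01 ge_min lexx. Qed.

Lemma clamp_id x : 0 <= x <= 1 -> clamp x = x.
Proof. by move=> /andP[x0 x1]; rewrite /clamp (min_r x1) (max_r x0). Qed.

Lemma clamp_eq0 x : x <= 0 -> clamp x = 0.
Proof. by move=> x0; rewrite /clamp max_l// ge_min x0 orbT. Qed.

Lemma clamp_eq1 x : 1 <= x -> clamp x = 1.
Proof. by move=> x1; rewrite /clamp min_l// max_r. Qed.

Lemma clamp_homo : {homo clamp : x y / x <= y}.
Proof.
move=> x y xy; rewrite /clamp ge_max le_max lexx/= le_max; apply/orP; right.
by rewrite le_min !ge_min lexx xy/= orbT.
Qed.

Lemma clamp_increment x y : x <= y -> clamp y - clamp x <= y - x.
Proof.
move=> xy; have := clamp_homo xy.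
have [x0|x0] := leP x 0; first rewrite (clamp_eq0 x0).
  have [y0|y0] := leP y 0; first by rewrite (clamp_eq0 y0); lra.
  have [y1|y1] := leP y 1; first by rewrite clamp_id; lra.
  by rewrite (@clamp_eq1 y); lra.
have [x1|x1] := leP x 1; last first.
  by rewrite !clamp_eq1; lra.
rewrite (@clamp_id x); last lra.
have [y1|y1] := leP y 1; first by rewrite clamp_id; lra.
by rewrite (@clamp_eq1 y); lra.
Qed.

End Clamp.

Section Volumes.
Context {R : realType} {n : nat}.
Implicit Types (f : 'rV[R]_n -> R) (a b u x : 'rV[R]_n).

Definition grounded f := forall u j, u 0 j <= 0 -> f u = 0.

(** The terms indexed by [J] and by [J] with [j] added cancel, as they
    evaluate [f] at the same vertex with opposite signs. *)
Lemma volume_degenerate f a b j : a 0 j = b 0 j -> volume f a b = 0.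
Proof.
move=> ab; rewrite /volume (bigID (fun J : {set 'I_n} => j \in J))/=.
rewrite [X in _ + X](reindex_onto (fun J => J :\ j) (fun J => j |: J))/=;
  last by move=> J jJ; rewrite finset.setU1K.
rewrite [X in _ + X](eq_bigl (fun J : {set 'I_n} => j \in J)); last first.
  move=> J; rewrite setD11/=; apply/idP/idP => [/eqP<-|/finset.setD1K->//].
  by rewrite setU11.
rewrite -big_split/= big1 // => J jJ.
rewrite (cardsD1 j J) jJ/= exprS mulN1r mulNr.
rewrite (_ : \row_i _ = \row_i (if i \in J :\ j then a 0 i else b 0 i)).
  by rewrite addNr.
apply/rowP => i; rewrite !mxE in_setD1.
by case: eqVneq => // ->; rewrite jJ.
Qed.

Lemma volume_grounded f a b :
  grounded f -> (forall j, a 0 j <= 0) -> volume f a b = f b.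
Proof.
move=> f0 a0; rewrite /volume (bigD1 finset.set0)//= big1 ?addr0.
  rewrite cards0 expr0 mul1r; congr f; apply/rowP => i.
  by rewrite mxE finset.in_set0.
move=> J /finset.set0Pn[j jJ]; rewrite (f0 _ j) ?mulr0//.
by rewrite mxE jJ.
Qed.

(** Nullness on a sup-norm ball around [x]. Unlike the open null boxes of the
    definition of the support it has a single parameter, so finitely many such
    conditions are met together by taking the least radius. *)
Definition null_near f x := exists2 e : R, 0 < e &
  forall a b, (forall i, a 0 i <= b 0 i) ->
    (forall i, [/\ 0 <= a 0 i, b 0 i <= 1, x 0 i - e < a 0 i
                 & b 0 i < x 0 i + e]) ->
  volume f a b = 0.

Lemma suppE f x : supp f x <-> unit_cube x /\ ~ null_near f x.
Proof.
split=> [[xc xn]|[xc xn]]; split=> //.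
- case=> e e0 Hn; apply: xn.
  pose K i : set R := ball (x 0 i) e `&` `[0, 1].
  exists (box K).
    exists K; split=> //.
    + move=> i; split; last by exists (ball (x 0 i) e); split=> //; exact: ball_open.
      move=> y z [yb y01] [zb z01] w /andP[yw wz]; split.
        move: yb zb; rewrite /ball/= /ball_/= !ltr_distlC; lra.
      by move: y01 z01; rewrite /= !in_itv/=; lra.
    + move=> a b ab sub; apply: Hn => // i.
      have /(_ i)[] := sub a (fun i => ltac:(rewrite lexx ab; exact: isT)).
      have /(_ i)[] := sub b (fun i => ltac:(rewrite lexx ab; exact: isT)).
      rewrite /ball/= /ball_/= !in_itv/= !ltr_distlC.
      move=> /andP[? ?] /andP[? ?] /andP[? ?] /andP[? ?]; split=> //.
  move=> i; split; first exact: ballxx.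
  by have := xc i; rewrite /= in_itv.
- move=> [B [K [Ko -> Kn]] xK]; apply: xn.
  have /choice[r eP] : forall i, exists e : R,
      0 < e /\ forall y, `|x 0 i - y| < e -> 0 <= y <= 1 -> K i y.
    move=> i; have [_ [U [Uo KU]]] := Ko i.
    have : nbhs (x 0 i) U.
      by apply: open_nbhs_nbhs; split=> //; have := xK i; rewrite KU => -[].
    move=> /nbhs_ballP[e/= e0 sub]; exists e; split=> // y ye y01.
    by rewrite KU; split; [exact: sub|rewrite /= in_itv].
  have [e e0 ee] := @finite_lower_bound _ _ r (fun i => (eP i).1).
  exists e => // a b ab abP; apply: Kn => // y /= yab i.
  apply: (eP i).2.
    have := ee i; have := yab i; case: (abP i) => *.
    by rewrite ltr_distlC; lra.
  by have := yab i; case: (abP i) => *; lra.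
Qed.

Lemma supp_sub_cube f : supp f `<=` unit_cube.
Proof. by move=> x []. Qed.

Lemma closed_supp f : closed (supp f).
Proof.
rewrite -(setCK (supp f)); apply: open_closedC.
rewrite openE => x; rewrite /= => xs; apply/nbhs_ballP.
have [xc|xc] := pselect (unit_cube x); last first.
  have /existsNP[i /negP xi] := xc.
  have [e e0 eP] : exists2 e : R, 0 < e &
      forall y, `|x 0 i - y| < e -> ~ (0 <= y <= 1).
    move: xi; rewrite negb_and -!ltNge => /orP[xi|xi].
      by exists (- x 0 i); [lra|move=> y; rewrite ltr_distlC; lra].
    by exists (x 0 i - 1); [lra|move=> y; rewrite ltr_distlC; lra].
  exists e => // y [_ /(_ 0 i) yb] /supp_sub_cube/(_ i).
  by apply: eP.
have [e e0 Hn] : null_near f x.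
  by apply: contrapT => xn; apply: xs; apply/suppE.
exists (e / 2); first by rewrite /= divr_gt0.
move=> y [_ yb] /suppE[_]; apply.
exists (e / 2); first by rewrite divr_gt0.
move=> a b ab abP; apply: Hn => // i.
have := yb 0 i; rewrite /ball/= ltr_distlC.
by case: (abP i) => *; split; lra.
Qed.

End Volumes.

(** * Functions with the order properties of copulas *)

Section CopulaLike.
Context {R : realType} {n : nat}.
Implicit Types (f : 'rV[R]_n -> R) (u v : 'rV[R]_n).

Definition upd u (j : 'I_n) (x : R) : 'rV[R]_n :=
  \row_i (if i == j then x else u 0 i).

Lemma upd_id u j : upd u j (u 0 j) = u.
Proof. by apply/rowP => i; rewrite mxE; case: eqP => [->|]. Qed.

(** Functions are constrained on the whole of R^n, through [clamp], so that no
    membership in the cube has to be carried along. *)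
Definition uniform_margins f := forall u k,
  (forall i, i != k -> 1 <= u 0 i) -> f u = clamp (u 0 k).

(** Monotonicity and the Lipschitz condition of a quasi-copula, one coordinate
    at a time. *)
Definition tame_increments f := forall u j x y, x <= y ->
  0 <= f (upd u j y) - f (upd u j x) <= clamp y - clamp x.

(** Two-dimensional volumes are nonnegative, the other coordinates being fixed.
    For a copula this follows from the nonnegativity of all volumes, but this
    weaker property is the one that makes up for negative masses in
    [tame_increments_signed]. *)
Definition supermodular f := forall u j k x x' y y', j != k ->
  x <= x' -> y <= y' ->
  f (upd (upd u j x') k y) - f (upd (upd u j x) k y) <=
  f (upd (upd u j x') k y') - f (upd (upd u j x) k y').

Definition copula_like f :=
  [/\ grounded f, uniform_margins f, tame_increments f & supermodular f].

Lemma tame_ge0 f u (j : 'I_n) : grounded f -> tame_increments f -> 0 <= f u.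
Proof.
move=> f0 ft; have [uj|uj] := leP (u 0 j) 0; first by rewrite (f0 _ _ uj).
have := ft u j _ _ (ltW uj); rewrite upd_id (f0 (upd u j 0) j) ?subr0.
  by case/andP.
by rewrite mxE eqxx.
Qed.

Lemma tame_le_margin f u j :
  grounded f -> tame_increments f -> f u <= clamp (u 0 j).
Proof.
move=> f0 ft; have [uj|uj] := leP (u 0 j) 0.
  by rewrite (f0 _ _ uj) clamp_ge0.
have := ft u j _ _ (ltW uj).
rewrite upd_id (f0 (upd u j 0) j) ?subr0 ?(@clamp_eq0 _ 0) ?subr0//.
  by case/andP.
by rewrite mxE eqxx.
Qed.

(** Passing from [u] to [v] one coordinate at a time. *)
Lemma tame_lipschitz f u v : tame_increments f ->
  `|f u - f v| <= \sum_i `|u 0 i - v 0 i|.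
Proof.
move=> ft.
pose w k : 'rV[R]_n := \row_i (if (i < k)%N then v 0 i else u 0 i).
have step (k : 'I_n) : `|f (w k) - f (w k.+1)| <= `|u 0 k - v 0 k|.
  have -> : w k = upd (w k) k (u 0 k).
    by apply/rowP => i; rewrite !mxE; case: eqP => // ->; rewrite ltnn.
  have -> : w k.+1 = upd (w k) k (v 0 k).
    apply/rowP => i; rewrite !mxE ltnS leq_eqVlt.
    by rewrite (inj_eq val_inj); case: eqP => // ->.
  have [uv|/ltW uv] := leP (u 0 k) (v 0 k).
    have := ft (w k) k _ _ uv; have := clamp_increment uv.
    rewrite distrC (distrC (u 0 k)) => ? ?.
    by rewrite !ger0_norm; lra.
  have := ft (w k) k _ _ uv; have := clamp_increment uv => ? ?.
  by rewrite !ger0_norm; lra.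
have -> : f u - f v = \sum_(k < n) (f (w k) - f (w k.+1)).
  rewrite -(big_mkord xpredT (fun k => f (w k) - f (w k.+1))).
  rewrite -[LHS]opprB -(eq_bigr _ (fun k _ => opprB _ _)).
  rewrite sumrN telescope_sumr//; congr (- (_ - _)); congr f;
    by apply/rowP => i; rewrite mxE ?ltn_ord.
by apply: (le_trans (ler_norm_sum _ _ _)); apply: ler_sum => k _; exact: step.
Qed.

Lemma tame_quasi_copula f : (0 < n)%N ->
  grounded f -> uniform_margins f -> tame_increments f -> quasi_copula f.
Proof.
move=> n0 f0 fm ft; pose j0 := Ordinal n0; split.
- move=> u uc; rewrite (tame_ge0 _ j0)//=.
  by rewrite (le_trans (tame_le_margin u j0 f0 ft))// clamp_le1.
- by move=> u uc [i ui]; rewrite (f0 u i)// ui.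
- move=> u k uc uk; rewrite (fm u k) ?clamp_id// => i ik.
  by rewrite (uk _ ik).
- move=> u v k uc vc uv kk; rewrite -subr_ge0.
  have ue : u = upd v k (u 0 k).
    by apply/rowP => i; rewrite mxE; case: eqVneq => [->//|/uv].
  by have /andP[] := ft v k _ _ kk; rewrite -ue upd_id.
- by move=> u v _ _; exact: tame_lipschitz.
Qed.

(** Every clause is an equality or a weak inequality between finitely many
    values. *)
Lemma copula_like_limit (F : nat -> 'rV[R]_n -> R) f :
  (forall m, copula_like (F m)) -> (forall u, F m u @[m --> \oo] --> f u) ->
  copula_like f.
Proof.
move=> FC Ff; split.
- move=> u j uj; apply: (cvg_unique _ (Ff u)) => //.
  apply: cvg_near_cst; apply: nearW => m.
  by have [F0 _ _ _] := FC m; exact: (F0 u j uj).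
- move=> u k uk; apply: (cvg_unique _ (Ff u)) => //.
  apply: cvg_near_cst; apply: nearW => m.
  by have [_ Fm _ _] := FC m; exact: (Fm u k uk).
- move=> u j x y xy.
  have cv : F m (upd u j y) - F m (upd u j x) @[m --> \oo] -->
      f (upd u j y) - f (upd u j x) by apply: cvgB; exact: Ff.
  apply/andP; split.
    apply: (ler_cvg_to (cvg_cst 0) cv); apply: nearW => m.
    by have [_ _ /(_ u j x y xy)/andP[]] := FC m.
  apply: (ler_cvg_to cv (cvg_cst _)); apply: nearW => m.
  by have [_ _ /(_ u j x y xy)/andP[]] := FC m.
- move=> u j k x x' y y' jk xx yy.
  have cv z z' w w' : F m (upd (upd u j z) k w) - F m (upd (upd u j z') k w')
      @[m --> \oo] --> f (upd (upd u j z) k w) - f (upd (upd u j z') k w').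
    by apply: cvgB; exact: Ff.
  apply: (ler_cvg_to (cv x' x y y) (cv x' x y' y')); apply: nearW => m.
  by have [_ _ _] := FC m; apply.
Qed.

Definition min_copula u : R := \big[Num.min/1]_j clamp (u 0 j).

Lemma min_copula_upd u j x : min_copula (upd u j x) =
  Num.min (clamp x) (\big[Num.min/1]_(i | i != j) clamp (u 0 i)).
Proof.
rewrite /min_copula (bigminD1 j)//= mxE eqxx; congr (Num.min _ _).
by apply: eq_bigr => i /negPf ij; rewrite mxE ij.
Qed.

Lemma min_copula_upd2 u j k x y : j != k ->
  min_copula (upd (upd u j x) k y) = Num.min (clamp y) (Num.min (clamp x)
    (\big[Num.min/1]_(i | (i != k) && (i != j)) clamp (u 0 i))).
Proof.
move=> jk; rewrite min_copula_upd (bigminD1 j)//= mxE eqxx.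
congr (Num.min _ (Num.min _ _)).
by apply: eq_bigr => i /andP[_ /negPf ij]; rewrite mxE ij.
Qed.

Lemma copula_like_min : (0 < n)%N -> copula_like min_copula.
Proof.
move=> n0; split.
- move=> u j uj; rewrite -(upd_id u j) min_copula_upd clamp_eq0// min_l//.
  by apply: le_bigmin => // i _; exact: clamp_ge0.
- move=> u k uk; rewrite -{1}(upd_id u k) min_copula_upd min_l//.
  apply: le_bigmin; first exact: clamp_le1.
  by move=> i ik; rewrite (clamp_eq1 (uk i ik)) clamp_le1.
- move=> u j x y xy; rewrite !min_copula_upd.
  move: (\big[_/_]_(_ | _) _) (clamp_homo xy) => m.
  by rewrite !minElt; case: ltP => ?; case: ltP => ?; lra.
- move=> u j k x x' y y' jk xx yy; rewrite !min_copula_upd2//.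
  move: (\big[_/_]_(_ | _) _) (clamp_homo xx) (clamp_homo yy) => m.
  move: (clamp x) (clamp x') (clamp y) (clamp y') => {xx yy u x y x' y'}p p' q q' *.
  have : Num.min p m <= Num.min p' m by rewrite le_min !ge_min lexx orbT andbT; lra.
  move: (Num.min p m) (Num.min p' m) => c c' *.
  by rewrite !minElt; case: ltP => ?; case: ltP => ?;
    case: ltP => ?; case: ltP => ?; lra.
Qed.

(** The upper Frechet-Hoeffding bound: iterating a transformation from
    [min_copula] therefore gives a decreasing sequence. *)
Lemma le_min_copula f u : (0 < n)%N -> copula_like f -> f u <= min_copula u.
Proof.
move=> n0 [f0 fm ft fs]; apply: le_bigmin => [|i _]; last exact: tame_le_margin.
exact: le_trans (tame_le_margin _ (Ordinal n0) f0 ft) (clamp_le1 _).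
Qed.

End CopulaLike.

(** * Gluing rescaled copies along separated cubes *)

Section Cells.
Context {R : realType} {n : nat} {I : finType}.
Variables (l : I -> 'rV[R]_n) (rho : I -> R).
Implicit Types (f : 'rV[R]_n -> R) (u : 'rV[R]_n) (t : I -> R).

(** Cube [i] has lower corner [l i] and side [rho i]; two distinct cubes are
    separated by a hyperplane orthogonal to some axis, which the cubes may
    touch. *)
Record cell_system : Prop := CellSystem {
  side_gt0 : forall i, 0 < rho i;
  side_lt1 : forall i, rho i < 1;
  corner_ge0 : forall i j, 0 <= l i 0 j;
  corner_le1 : forall i j, l i 0 j + rho i <= 1;
  separated : forall i k, i != k -> exists j,
    l i 0 j + rho i <= l k 0 j \/ l k 0 j + rho k <= l i 0 j }.

Definition local_coord i j (x : R) : R := clamp ((x - l i 0 j) / rho i).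

Definition localize i u : 'rV[R]_n := \row_j local_coord i j (u 0 j).

Definition embed i u : 'rV[R]_n := l i + rho i *: u.

(** If [f] is the distribution function of a signed mass on the cube, this is
    the distribution function of the sum over [i] of [t i] times its copy in
    cube [i]. *)
Definition transform t f u : R := \sum_i t i * f (localize i u).

(** The weights for which [transform] preserves uniform margins: the masses in
    every slab add up to its width. *)
Definition marginal_weights t :=
  forall j x, \sum_i t i * local_coord i j x = clamp x.

Hypothesis cells : cell_system.

Let rho0 := side_gt0 cells.

Lemma local_coord_eq0 i j x : x <= l i 0 j -> local_coord i j x = 0.
Proof.
by move=> xl; apply: clamp_eq0; rewrite pmulr_lle0 ?invr_gt0 ?rho0// subr_le0.
Qed.

Lemma local_coord_eq1 i j x : l i 0 j + rho i <= x -> local_coord i j x = 1.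
Proof.
by move=> xl; apply: clamp_eq1; rewrite ler_pdivlMr ?rho0// mul1r lerBrDl.
Qed.

Lemma local_coord_homo i j : {homo local_coord i j : x y / x <= y}.
Proof.
by move=> x y xy; apply: clamp_homo; rewrite ler_pM2r ?invr_gt0 ?rho0// lerB.
Qed.

Lemma local_coord_increment i j x y : x <= y ->
  local_coord i j y - local_coord i j x <= (y - x) / rho i.
Proof.
move=> xy; apply: (le_trans (clamp_increment _)).
  by rewrite ler_pM2r ?invr_gt0 ?rho0// lerB.
by rewrite -mulrBl opprB addrA subrK.
Qed.

Lemma clamp_local_coord i j x : clamp (local_coord i j x) = local_coord i j x.
Proof. by rewrite clamp_id// clamp_ge0 clamp_le1. Qed.

Lemma localize_in_cube i u : unit_cube (localize i u).
Proof. by move=> j; rewrite mxE clamp_ge0 clamp_le1. Qed.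

Lemma localize_upd i u j x :
  localize i (upd u j x) = upd (localize i u) j (local_coord i j x).
Proof. by apply/rowP => k; rewrite !mxE; case: eqP => // ->. Qed.

Lemma embedE i u j : embed i u 0 j = l i 0 j + rho i * u 0 j.
Proof. by rewrite !mxE. Qed.

Lemma localize_embed i u : unit_cube u -> localize i (embed i u) = u.
Proof.
move=> uc; apply/rowP => j; rewrite mxE embedE /local_coord addrC addKr.
by rewrite mulrC mulKf ?clamp_id// gt_eqF ?rho0.
Qed.

Lemma embed_localize i u :
  (forall j, l i 0 j <= u 0 j <= l i 0 j + rho i) -> embed i (localize i u) = u.
Proof.
move=> ui; apply/rowP => j; rewrite embedE mxE /local_coord clamp_id.
  by rewrite mulrCA divff ?gt_eqF ?rho0// mulr1 addrC subrK.
rewrite divr_ge0 ?subr_ge0 ?(ltW (rho0 i))//=; last by case/andP: (ui j).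
by rewrite ler_pdivrMr ?rho0// mul1r lerBlDl; case/andP: (ui j).
Qed.

Lemma embed_in_cell i u : unit_cube u ->
  forall j, l i 0 j <= embed i u 0 j <= l i 0 j + rho i.
Proof.
move=> uc j; rewrite embedE lerDl mulr_ge0 ?(ltW (rho0 i))//=; last first.
  by case/andP: (uc j).
by rewrite lerD2l -{2}(mulr1 (rho i)) ler_pM2l ?rho0//; case/andP: (uc j).
Qed.

Lemma embed_in_cube i u : unit_cube u -> unit_cube (embed i u).
Proof.
move=> uc j; have /andP[h1 h2] := embed_in_cell i uc j.
by rewrite (le_trans (corner_ge0 cells i j) h1) (le_trans h2)// corner_le1.
Qed.

(** Seen from cube [k], cube [i] is flat in the coordinate separating them; so
    boxes inside cube [i] receive no volume from the copy in cube [k]. *)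
Lemma localize_embed_other i k : i != k -> exists j, forall u v,
  unit_cube u -> unit_cube v ->
  localize k (embed i u) 0 j = localize k (embed i v) 0 j.
Proof.
move=> ik; have [j jP] := separated cells ik; exists j => u v uc vc.
rewrite !mxE -!embedE.
have /andP[u1 u2] := embed_in_cell i uc j.
have /andP[v1 v2] := embed_in_cell i vc j.
case: jP => jP.
  by rewrite !local_coord_eq0// (le_trans _ jP).
by rewrite !local_coord_eq1// (le_trans jP).
Qed.

Lemma embed_edist i u v :
  Defs.edist (embed i u) (embed i v) = rho i * Defs.edist u v.
Proof.
rewrite /Defs.edist -[X in X * _](ger0_norm (ltW (rho0 i))) -sqrtr_sqr.
rewrite -sqrtrM ?sqr_ge0// mulr_sumr; congr Num.sqrt; apply: eq_bigr => j _.
by rewrite !embedE; ring.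
Qed.

Lemma volume_transform t f a b :
  volume (transform t f) a b = \sum_i t i * volume f (localize i a) (localize i b).
Proof.
rewrite /volume /transform.
under eq_bigr do rewrite mulr_sumr.
rewrite exchange_big/=; apply: eq_bigr => i _.
rewrite mulr_sumr; apply: eq_bigr => J _; rewrite mulrCA; congr (_ * (_ * f _)).
by apply/rowP => j; rewrite !mxE; case: ifP.
Qed.

(** A copy whose cube does not contain [x] is degenerate on all small boxes
    around [x]; the copies whose cubes contain [x] vanish there by
    assumption. *)
Lemma null_near_transform t f (x : 'rV[R]_n) :
  (forall i, (forall j, l i 0 j <= x 0 j <= l i 0 j + rho i) ->
    null_near f (localize i x)) ->
  null_near (transform t f) x.
Proof.
move=> xn.
have /choice[r rP] : forall i, exists e : R, 0 < e /\
    forall a b : 'rV[R]_n, (forall j, a 0 j <= b 0 j) ->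
      (forall j, x 0 j - e < a 0 j /\ b 0 j < x 0 j + e) ->
    volume f (localize i a) (localize i b) = 0.
  move=> i; have [xi|] := pselect (forall j, l i 0 j <= x 0 j <= l i 0 j + rho i).
    have [e e0 He] := xn i xi; exists (e * rho i); split.
      by rewrite mulr_gt0 ?rho0.
    move=> a b ab abx; apply: He => [j|j]; rewrite !mxE.
      exact: local_coord_homo.
    have [ax bx] := abx j; split; [exact: clamp_ge0|exact: clamp_le1| |].
      have [xa|/ltW xa] := leP (x 0 j) (a 0 j).
        by have := local_coord_homo i j xa; lra.
      suff : local_coord i j (x 0 j) - local_coord i j (a 0 j) < e by lra.
      apply: le_lt_trans (local_coord_increment _ _ xa) _.
      by rewrite ltr_pdivrMr ?rho0//; lra.
    have [xb|/ltW xb] := leP (b 0 j) (x 0 j).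
      by have := local_coord_homo i j xb; lra.
    suff : local_coord i j (b 0 j) - local_coord i j (x 0 j) < e by lra.
    apply: le_lt_trans (local_coord_increment _ _ xb) _.
    by rewrite ltr_pdivrMr ?rho0//; lra.
  move=> /existsNP[j /negP]; rewrite negb_and -!ltNge => /orP[xj|xj].
    exists (l i 0 j - x 0 j); split; first by rewrite subr_gt0.
    move=> a b ab abx; apply: (@volume_degenerate _ _ _ _ _ j).
    by have := ab j; case: (abx j) => *; rewrite !mxE !local_coord_eq0//; lra.
  exists (x 0 j - (l i 0 j + rho i)); split; first by rewrite subr_gt0.
  move=> a b ab abx; apply: (@volume_degenerate _ _ _ _ _ j).
  by have := ab j; case: (abx j) => *; rewrite !mxE !local_coord_eq1//; lra.
have [e e0 eP] := finite_lower_bound (fun i => (rP i).1).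
exists e => // a b ab abx; rewrite volume_transform big1// => i _.
rewrite (rP i).2 ?mulr0// => j.
by have := eP i; case: (abx j) => *; split; lra.
Qed.

(** Inside cube [i] the volumes of [transform t f] are [t i] times those of
    [f], whatever the other weights are. *)
Lemma null_near_transform_embed t f i (x : 'rV[R]_n) : t i != 0 -> unit_cube x ->
  null_near (transform t f) (embed i x) -> null_near f x.
Proof.
move=> ti xc [e e0 He]; exists e => // a b ab abx.
have ac : unit_cube a by move=> j; have := ab j; case: (abx j); lra.
have bc : unit_cube b by move=> j; have := ab j; case: (abx j); lra.
have r1 : rho i < 1 := side_lt1 cells i.
have : volume (transform t f) (embed i a) (embed i b) = 0.
  apply: He => j.
    by rewrite !embedE lerD2l ler_pM2l ?rho0.
  have /andP[a1 _] := embed_in_cube i ac j.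
  have /andP[_ b1] := embed_in_cube i bc j.
  split=> //; have [_ _ ax bx] := abx j; rewrite !embedE.
    have : rho i * (x 0 j - a 0 j) < e; last by lra.
    have [xa|xa] := leP (x 0 j) (a 0 j).
      by apply: le_lt_trans e0; rewrite pmulr_rle0 ?rho0// subr_le0.
    apply: lt_trans (_ : x 0 j - a 0 j < e); last by lra.
    by rewrite gtr_pMl// subr_gt0.
  have : rho i * (b 0 j - x 0 j) < e; last by lra.
  have [xb|xb] := leP (b 0 j) (x 0 j).
    by apply: le_lt_trans e0; rewrite pmulr_rle0 ?rho0// subr_le0.
  apply: lt_trans (_ : b 0 j - x 0 j < e); last by lra.
  by rewrite gtr_pMl// subr_gt0.
rewrite volume_transform (bigD1 i)//= big1 ?addr0; last first.
  move=> k ki; rewrite eq_sym in ki.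
  have [j /(_ a b ac bc) jP] := localize_embed_other ki.
  by rewrite (volume_degenerate _ jP) mulr0.
by rewrite !localize_embed// => /eqP; rewrite mulf_eq0 (negPf ti) => /eqP.
Qed.

(** The signs of the weights do not matter: masses in different cubes cannot
    cancel, since every box around a point of the support contains boxes of
    nonzero volume lying in a single cube. *)
Lemma supp_transform t f : (forall i, t i != 0) ->
  supp (transform t f) = \bigcup_i (embed i @` supp f).
Proof.
move=> t0; apply/seteqP; split=> x.
- move=> /suppE[xc xn]; apply: contrapT => xE; apply: xn.
  apply: null_near_transform => i xi; apply: contrapT => fn; apply: xE.
  exists i => //; exists (localize i x); last exact: embed_localize.
  by apply/suppE; split=> //; exact: localize_in_cube.
- move=> [i _ [y /suppE[yc yn] <-]]; apply/suppE; split.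
    exact: embed_in_cube.
  by move=> /(null_near_transform_embed (t0 i) yc).
Qed.

Lemma grounded_transform t f : grounded f -> grounded (transform t f).
Proof.
move=> f0 u j uj; rewrite /transform big1// => i _; rewrite (f0 _ j) ?mulr0//.
by rewrite mxE local_coord_eq0// (le_trans uj)// corner_ge0.
Qed.

Lemma uniform_margins_transform t f : marginal_weights t ->
  uniform_margins f -> uniform_margins (transform t f).
Proof.
move=> tm fm u k uk; rewrite -(tm k); apply: eq_bigr => i _; congr (_ * _).
rewrite (fm _ k); first by rewrite mxE clamp_local_coord.
move=> j jk; rewrite mxE local_coord_eq1// (le_trans _ (uk j jk))//.
exact: corner_le1.
Qed.

Lemma tame_increments_transform t f : (forall i, 0 <= t i) -> marginal_weights t ->
  tame_increments f -> tame_increments (transform t f).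
Proof.
move=> t0 tm ft u j x y xy; rewrite /transform -!sumrB.
have h i := ft (localize i u) j _ _ (local_coord_homo i j xy).
apply/andP; split.
  apply: sumr_ge0 => i _; rewrite -mulrBr !localize_upd mulr_ge0//.
  by case/andP: (h i).
rewrite -!(tm j) -sumrB; apply: ler_sum => i _.
rewrite -!mulrBr !localize_upd ler_wpM2l//.
by case/andP: (h i); rewrite !clamp_local_coord.
Qed.

Lemma supermodular_transform t f : (forall i, 0 <= t i) ->
  supermodular f -> supermodular (transform t f).
Proof.
move=> t0 fs u j k x x' y y' jk xx yy; rewrite /transform -!sumrB.
apply: ler_sum => i _; rewrite -!mulrBr !localize_upd ler_wpM2l//.
by apply: fs => //; exact: local_coord_homo.
Qed.

Lemma copula_like_transform t f : (forall i, 0 <= t i) -> marginal_weights t ->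
  copula_like f -> copula_like (transform t f).
Proof.
move=> t0 tm [? ? ? ?]; split;
  [exact: grounded_transform|exact: uniform_margins_transform|
   exact: tame_increments_transform|exact: supermodular_transform].
Qed.

(** As [transform t] is monotone, its iterates on the largest function of the
    class decrease; the limit is a fixed point because [transform] is a finite
    sum. *)
Lemma transform_fixed_point t : (0 < n)%N -> (forall i, 0 <= t i) ->
  marginal_weights t -> exists2 f, copula_like f & transform t f = f.
Proof.
move=> n0 t0 tm; pose F m := iter m (transform t) (@min_copula R n).
have FC m : copula_like (F m).
  elim: m => [|m IH]; first exact: copula_like_min.
  by rewrite /F iterS; exact: copula_like_transform.
have Fdec m u : F m.+1 u <= F m u.
  elim: m u => [|m IH] u; first exact: le_min_copula.
  by apply: ler_sum => i _; rewrite ler_wpM2l//; exact: IH.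
have Fcv u : cvgn (F ^~ u).
  apply: nonincreasing_is_cvgn; first by apply/nonincreasing_seqP => m; exact: Fdec.
  exists 0 => _ [m _ <-]; have [? _ ? _] := FC m.
  exact: (tame_ge0 _ (Ordinal n0)).
pose f u := limn (F ^~ u); exists f; first by apply: copula_like_limit FC _ => u; exact: Fcv.
apply/funext => u.
have cvf : F m.+1 u @[m --> \oo] --> f u.
  by have := Fcv u; rewrite -(cvg_shiftS (F ^~ u)).
have cvp : F m.+1 u @[m --> \oo] --> transform t f u.
  have cvs (r : seq I) : \sum_(i <- r) t i * F m (localize i u) @[m --> \oo]
      --> \sum_(i <- r) t i * f (localize i u).
    elim: r => [|i r IH].
      by rewrite big_nil; under eq_cvg do rewrite big_nil; exact: cvg_cst.
    rewrite big_cons; under eq_cvg do rewrite big_cons.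
    by apply: cvgD; [apply: cvgMl_tmp; exact: Fcv|exact: IH].
  exact: cvs.
exact: (cvg_unique _ cvp cvf).
Qed.

End Cells.

(** * Dimensions from regularity of covers *)

Section Covers.
Context {R : realType} {n : nat}.
Implicit Types (U A B E : set 'rV[R]_n) (x y : 'rV[R]_n) (d s t : R).

Lemma coord_le_edist x y j : `|x 0 j - y 0 j| <= Defs.edist x y.
Proof.
rewrite -sqrtr_sqr ler_sqrt ?sumr_ge0// => [|i _]; last exact: sqr_ge0.
by rewrite (bigD1 j)//= lerDl sumr_ge0// => i _; exact: sqr_ge0.
Qed.

Lemma le_diam U x y : U x -> U y -> ((Defs.edist x y)%:E <= diam U)%E.
Proof. by move=> Ux Uy; apply: ereal_sup_ubound; right; exists x => //; exists y. Qed.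

Lemma diam_ge0 U : (0 <= diam U)%E.
Proof. by apply: ereal_sup_ubound; left. Qed.

Lemma diam_le U d : 0 <= d ->
  (forall x y, U x -> U y -> Defs.edist x y <= d) -> (diam U <= d%:E)%E.
Proof.
move=> d0 Ud; apply/ereal_supP => _ [->|[x Ux [y Uy <-]]]; rewrite lee_fin//.
exact: Ud.
Qed.

Lemma diam_set0_le d : 0 <= d -> (diam (set0 : set 'rV[R]_n) <= d%:E)%E.
Proof. by move=> d0; exact: diam_le. Qed.

Lemma diam_pow_ge0 t U : (0 <= diam_pow t U)%E.
Proof. by rewrite /diam_pow; case: ifP => // _; exact: poweR_ge0. Qed.

Lemma diam_fin U d : (diam U <= d%:E)%E ->
  exists2 e, 0 <= e <= d & diam U = e%:E.
Proof.
move=> Ud; have : diam U \is a fin_num.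
  by rewrite ge0_fin_numE ?diam_ge0// (le_lt_trans Ud)// ltry.
move=> /fineK Ue; exists (fine (diam U)) => //.
by rewrite -!lee_fin Ue diam_ge0.
Qed.

Lemma diam_pow_le t U d : 0 <= t -> (diam U <= d%:E)%E ->
  (diam_pow t U <= (d `^ t)%:E)%E.
Proof.
move=> t0 Ud; rewrite /diam_pow; case: ifP => _; first by rewrite lee_fin powR_ge0.
have [e /andP[e0 ed] ->] := diam_fin Ud.
by rewrite poweR_EFin lee_fin; exact: le_powR.
Qed.

Lemma diam_pow_antitone s t U : 0 <= t -> t <= s -> (diam U <= 1)%E ->
  (diam_pow s U <= diam_pow t U)%E.
Proof.
move=> t0 ts Ud; rewrite /diam_pow; case: ifP => // _.
have [e /andP[e0 ed] ->] := diam_fin Ud.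
rewrite !poweR_EFin lee_fin; have [->|en0] := eqVneq e 0.
  have [s0|/powR0->] := eqVneq s 0; last exact: powR_ge0.
  by rewrite s0 (_ : t = 0)//; apply/le_anti; rewrite t0 andbT -s0.
by apply: ger_powR => //; rewrite ed andbT lt0r en0 e0.
Qed.

Definition coverable d E m := exists U : 'I_m -> set 'rV[R]_n,
  (forall k, (diam (U k) <= d%:E)%E) /\ E `<=` \bigcup_k U k.

Lemma coverable_union d A B m m' :
  coverable d A m -> coverable d B m' -> coverable d (A `|` B) (m + m').
Proof.
move=> [U [Ud AU]] [V [Vd BV]].
exists (fun k : 'I_(m + m') => match fintype.split k with inl i => U i | inr i => V i end); split.
  by move=> k; case: fintype.split.
move=> x [/AU[i _ Ui]|/BV[i _ Vi]].
  by exists (unsplit (inl i)) => //; rewrite unsplitK.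
by exists (unsplit (inr i)) => //; rewrite unsplitK.
Qed.

Lemma coverable_bigcup (I : finType) d (A : I -> set 'rV[R]_n) (m : I -> nat) :
  (forall i, coverable d (A i) (m i)) ->
  coverable d (\bigcup_i A i) (\sum_i m i)%N.
Proof.
move=> Am.
have : coverable d (\bigcup_(i in [set i | i \in index_enum I]) A i)
    (\sum_(i <- index_enum I) m i)%N.
  elim: (index_enum I) => [|i r IH].
    rewrite big_nil; exists (fun=> set0); split; first by case.
    by move=> x [].
  rewrite big_cons; have [U [Ud sub]] := coverable_union (Am i) IH.
  exists U; split=> // x [j /=]; rewrite in_cons => /orP[/eqP->|jr] Ax.
    by apply: sub; left.
  by apply: sub; right; exists j.
move=> [U [Ud sub]]; exists U; split=> // x [i _ Ax]; apply: sub.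
by exists i => //=; rewrite mem_index_enum.
Qed.

(** A finite cover is completed by empty sets, which are free of cost. *)
Lemma coverable_sequence d t E m : 0 <= t -> 0 <= d -> coverable d E m ->
  exists U : (set 'rV[R]_n)^nat,
  [/\ forall k, (diam (U k) <= d%:E)%E, E `<=` \bigcup_k U k
    & (\sum_(0 <= k <oo) diam_pow t (U k) <= (m%:R * d `^ t)%:E)%E].
Proof.
move=> t0 d0 [V [Vd EV]].
pose U k := if insub k is Some i then V i else set0.
have Ud k : (diam (U k) <= d%:E)%E.
  by rewrite /U; case: insubP => // _; exact: diam_set0_le.
exists U; split=> //.
  by move=> x /EV[i _ Vi]; exists (val i) => //; rewrite /U valK.
apply: lime_le.
  by apply: is_cvg_nneseries => k _ _; exact: diam_pow_ge0.
apply: nearW => N.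
have partial M : (\sum_(0 <= k < M) diam_pow t (U k) <=
    ((minn M m)%:R * d `^ t)%:E)%E.
  elim: M => [|M IH]; first by rewrite big_geq// min0n mul0r.
  rewrite big_nat_recr//=; have [Mm|mM] := ltnP M m.
    move: IH; rewrite (minn_idPl (ltnW Mm)) => IH.
    rewrite (minn_idPl Mm) -addn1 natrD mulrDl mul1r EFinD.
    by apply: leeD IH _; exact: diam_pow_le.
  have -> : U M = set0 by rewrite /U insubF// ltnNge mM.
  by move: IH; rewrite /diam_pow eqxx adde0 !(minn_idPr _)// ltnW.
apply: le_trans (partial N) _; rewrite lee_fin ler_wpM2r ?powR_ge0//.
by rewrite ler_nat geq_minr.
Qed.

Definition upper_regular s E := exists2 K, 0 < K &
  forall d, 0 < d <= 1 -> exists2 m, coverable d E m & m%:R <= K * d^-1 `^ s.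

(** Positivity of the s-dimensional Hausdorff content, tested on covers by
    small sets only. *)
Definition content_positive s E := exists2 c, 0 < c &
  forall U : (set 'rV[R]_n)^nat, (forall k, (diam (U k) <= (4^-1)%:E)%E) ->
    E `<=` \bigcup_k U k -> (c%:E <= \sum_(0 <= k <oo) diam_pow s (U k))%E.

Lemma hausdorff_measure_gt0 s t E : 0 <= t -> t <= s ->
  content_positive s E -> (0 < hausdorff_measure t E)%E.
Proof.
move=> t0 ts [c c0 HL].
apply: (@lt_le_trans _ _ c%:E); first by rewrite lte_fin.
apply: (@le_trans _ _ (hausdorff_premeasure t 4^-1 E)); last first.
  by apply: ereal_sup_ubound; exists 4^-1 => //=; rewrite invr_gt0.
apply/ereal_infP => _ [U [Ud EU] <-].
apply: le_trans (HL U Ud EU) _; apply: lee_nneseries => k *.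
  exact: diam_pow_ge0.
apply: diam_pow_antitone => //; apply: le_trans (Ud k) _.
by rewrite lee_fin invf_le1// ler1n.
Qed.

(** The covers at scale [r] cost at most [K * r ^ (t - s)], which tends to 0. *)
Lemma hausdorff_measure_eq0 s t E : 0 <= t -> s < t ->
  upper_regular s E -> hausdorff_measure t E = 0%E.
Proof.
move=> t0 st [K K0 HU].
have ts0 : 0 < t - s by rewrite subr_gt0.
have pre_ge0 d : (0 <= hausdorff_premeasure t d E)%E.
  apply/ereal_infP => _ [U _ <-].
  by apply: nneseries_ge0 => k *; exact: diam_pow_ge0.
apply/eqP; rewrite eq_le; apply/andP; split; last first.
  apply: le_trans (pre_ge0 1) _.
  by apply: ereal_sup_ubound; exists 1 => //=.
apply/ereal_supP => _ [d /= d0 <-]; apply/lee_addgt0Pr => e e0; rewrite add0e.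
(* small enough for r <= d and for K * r ^ (t - s) <= e *)
pose r := Num.min (Num.min d 1) ((e / K) `^ (t - s)^-1).
have r0 : 0 < r by rewrite !lt_min d0 ltr01 powR_gt0// divr_gt0.
have rd : r <= d by rewrite !ge_min lexx.
have r1 : r <= 1 by rewrite !ge_min lexx orbT.
have re : K * r `^ (t - s) <= e.
  rewrite mulrC -ler_pdivlMr//.
  have : r <= (e / K) `^ (t - s)^-1 by rewrite !ge_min lexx !orbT.
  move=> /(le_powR (ltW ts0) (ltW r0)); rewrite -powRrM mulVf ?gt_eqF//.
  by rewrite powRr1// ltW// divr_gt0.
have [|m Em mK] := HU r; first by rewrite r0.
have [U [Ud EU US]] := coverable_sequence t0 (ltW r0) Em.
apply: (@le_trans _ _ (\sum_(0 <= k <oo) diam_pow t (U k))%E).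
  apply: ereal_inf_lbound; exists U => //; split=> // k.
  by apply: le_trans (Ud k) _; rewrite lee_fin.
apply: le_trans US _; rewrite lee_fin; apply: le_trans re.
apply: le_trans (ler_wpM2r (powR_ge0 _ _) mK) _.
rewrite -mulrA ler_wpM2l// ?(ltW K0)// -powR_inv1 ?(ltW r0)// -powRrM mulN1r.
by rewrite -powRD ?gt_eqF ?implybT// addrC.
Qed.

Lemma hausdorff_dim_eq s E : 0 <= s ->
  upper_regular s E -> content_positive s E -> hausdorff_dim E = s%:E.
Proof.
move=> s0 HU HL; apply/eqP; rewrite eq_le; apply/andP; split.
  apply/lee_addgt0Pr => e e0; apply: ereal_inf_lbound.
  have se0 : 0 <= s + e by rewrite addr_ge0// ltW.
  exists (s + e) => //; split=> //.
  by apply: hausdorff_measure_eq0 HU => //; rewrite ltrDl.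
apply/ereal_infP => _ [t [t0 Ht] <-]; rewrite lee_fin leNgt.
apply/negP => /ltW ts; have := hausdorff_measure_gt0 t0 ts HL.
by rewrite Ht ltxx.
Qed.

(** The lower bound is the positivity of the content, tested on covers all of
    whose sets have diameter at most [d]. *)
Lemma covering_number_bounds s E : 0 <= s ->
  upper_regular s E -> content_positive s E ->
  exists c K, [/\ 0 < c, 0 < K & forall d, 0 < d <= 4^-1 ->
    exists r, [/\ covering_number d E = r%:E,
      c * d^-1 `^ s <= r & r <= K * d^-1 `^ s]].
Proof.
move=> s0 [K K0 HU] [c c0 HL]; exists c, K; split=> // d /andP[d0 d4].
have [|m Em mK] := HU d.
  by rewrite d0 (le_trans d4)// invf_le1// ler1n.
have Nm : (covering_number d E <= m%:R%:E)%E.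
  by apply: ereal_inf_lbound; exists m.
have cN : ((c * d^-1 `^ s)%:E <= covering_number d E)%E.
  apply/ereal_infP => _ [k Ek <-]; rewrite lee_fin.
  have [U [Ud EU US]] := coverable_sequence s0 (ltW d0) Ek.
  have : (c%:E <= (k%:R * d `^ s)%:E)%E.
    apply: le_trans US; apply: HL => // j.
    by apply: le_trans (Ud j) _; rewrite lee_fin.
  rewrite lee_fin -powR_inv1 ?(ltW d0)// -powRrM mulN1r powRN.
  by rewrite ler_pdivrMr ?powR_gt0.
have : covering_number d E \is a fin_num.
  by rewrite fin_numElt (lt_le_trans (ltNyr _) cN) (le_lt_trans Nm (ltry _)).
move=> /fineK NE; exists (fine (covering_number d E)); split=> //.
  by rewrite -lee_fin NE.
by apply: le_trans mK; rewrite -lee_fin NE.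
Qed.

Lemma box_dim_eq s E : 0 <= s ->
  upper_regular s E -> content_positive s E -> has_box_dim E s%:E.
Proof.
move=> s0 HU HL; have [c [K [c0 K0 HN]]] := covering_number_bounds s0 HU HL.
have cvg_bound (a : R) : (s - a / ln d)%:E @[d --> 0^'+] --> s%:E.
  apply: cvg_EFin; first exact: nearW.
  rewrite -[X in _ --> X]subr0; apply: cvgB; first exact: cvg_cst.
  rewrite -[X in _ --> X](mulr0 a); apply: cvgMl_tmp.
  apply/ltr0_cvgV0; last exact: lnNy.
  near=> d; apply: ln_lt0; apply/andP; split; near: d.
    exact: nbhs_right_gt.
  exact: nbhs_right_lt.
apply: squeeze_cvge (cvg_bound (ln c)) (cvg_bound (ln K)).
near=> d.
have d0 : 0 < d by near: d; exact: nbhs_right_gt.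
have d4 : d <= 4^-1 by near: d; apply: nbhs_right_le; rewrite invr_gt0.
have lnd : ln d < 0.
  by rewrite ln_lt0// d0 (le_lt_trans d4)// invf_lt1// ltr1n.
have [|r [-> cr rK]] := HN d; first by rewrite d0.
have p0 : 0 < d^-1 `^ s by rewrite powR_gt0 ?invr_gt0.
have r0 : 0 < r by apply: lt_le_trans cr; rewrite mulr_gt0.
have ln_bound (a : R) : 0 < a -> ln (a * d^-1 `^ s) = ln a - s * ln d.
  move=> a0; rewrite lnM ?posrE// ln_powR lnV ?posrE//.
  by rewrite mulrN.
rewrite lne_EFin// inver (lt_eqF lnd) -EFinM -EFinN !lee_fin.
have cr' : ln c - s * ln d <= ln r.
  by rewrite -ln_bound// ler_ln ?posrE ?mulr_gt0.
have rK' : ln r <= ln K - s * ln d.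
  by rewrite -ln_bound// ler_ln ?posrE ?mulr_gt0.
have e (a : R) : s - a / ln d = (a - s * ln d) / - ln d.
  by field; rewrite lt_eqF.
have -> : - (ln r / ln d) = ln r / - ln d by rewrite invrN mulrN.
rewrite !e; apply/andP; split; rewrite ler_pM2r//;
  by rewrite invr_gt0 oppr_gt0.
Unshelve. all: by end_near.
Qed.

End Covers.

(** * Covers of a self-similar set *)

Section Dimension.
Context {R : realType} {n : nat} {I : finType}.
Variables (l : I -> 'rV[R]_n) (rho : I -> R) (s : R) (E : set 'rV[R]_n).
Hypothesis cells : cell_system l rho.
Hypothesis moran : \sum_i rho i `^ s = 1.
Hypothesis E_cube : E `<=` unit_cube.
Hypothesis E_self : E = \bigcup_i (embed l rho i @` E).
Hypothesis n_gt0 : (0 < n)%N.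
Hypothesis s_ge0 : 0 <= s.

Let rho0 := side_gt0 cells.

Lemma side_bounds : exists lo hi : R,
  [/\ 0 < lo <= 1, 0 < hi < 1 & forall i, lo <= rho i <= hi].
Proof.
have [e e0 eP] := finite_lower_bound rho0.
have [f f0 fP] := finite_lower_bound
  (fun i => etrans (subr_gt0 _ _) (side_lt1 cells i)).
exists (Num.min e 1), (1 - Num.min f 2^-1); split.
- by rewrite lt_min e0 ltr01 ge_min lexx orbT.
- have : 0 < Num.min f 2^-1 by rewrite lt_min f0 invr_gt0 ltr0n.
  have : Num.min f 2^-1 <= 2^-1 by rewrite ge_min lexx orbT.
  by lra.
- move=> i; rewrite ge_min eP/=.
  have : Num.min f 2^-1 <= f by rewrite ge_min lexx.
  by have := fP i; lra.
Qed.

Lemma coverable_embed i d A m : 0 <= d ->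
  coverable d A m -> coverable (rho i * d) (embed l rho i @` A) m.
Proof.
move=> d0 [U [Ud AU]]; exists (fun k => embed l rho i @` U k); split.
  move=> k; apply: diam_le; first by rewrite mulr_ge0// ltW.
  move=> _ _ [x Ux <-] [y Uy <-]; rewrite embed_edist// ler_wpM2l ?(ltW (rho0 i))//.
  by rewrite -lee_fin; apply: le_trans (le_diam Ux Uy) (Ud k).
by move=> _ [x /AU[k _ Uk] <-]; exists k => //; exists x.
Qed.

Lemma cube_edist (x y : 'rV[R]_n) : unit_cube x -> unit_cube y ->
  Defs.edist x y <= n%:R.
Proof.
move=> xc yc; rewrite -[leRHS]ger0_norm ?ler0n// -sqrtr_sqr ler_wsqrtr//.
apply: (@le_trans _ _ (\sum_(i < n) 1)).
  apply: ler_sum => i _; rewrite -real_normK ?num_real// exprn_ile1//.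
  by have := xc i; have := yc i; rewrite ler_norml; lra.
rewrite sumr_const card_ord -natrX ler_nat -mulnn.
exact: leq_pmulr.
Qed.

(** Covering each of the pieces of [E] at scale [d] amounts to covering [E] at
    the larger scale [d / rho i], and by Moran's equation the function d^-s
    satisfies the resulting recursion exactly. The induction is on the number
    of steps needed to reach a scale exceeding the diameter of the cube. *)
Lemma upper_regular_self_similar : upper_regular s E.
Proof.
have [lo [hi [/andP[lo0 lo1] hi01 lohi]]] := side_bounds.
have /andP[hi0 hi1] := hi01.
pose D : R := n%:R.
have D1 : 1 <= D by rewrite ler1n.
have D0 : 0 < D := lt_le_trans ltr01 D1.
exists ((D / lo) `^ s); first by rewrite powR_gt0 ?divr_gt0.
suff claim k d : 0 < d -> D * hi ^+ k <= d -> d <= D / lo ->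
    exists2 m, coverable d E m & m%:R <= (D / lo) `^ s * d^-1 `^ s.
  move=> d /andP[d0 d1]; have [k kd] := exists_exp_le hi01 (divr_gt0 d0 D0).
  apply: (claim k) => //; first by rewrite mulrC -ler_pdivlMr.
  by rewrite ler_pdivlMr// (le_trans _ D1)// mulr_ile1// ltW.
move: k d.
(* at scales above the diameter of the cube a single set suffices *)
have coarse d : 0 < d -> D <= d -> d <= D / lo ->
    exists2 m, coverable d E m & m%:R <= (D / lo) `^ s * d^-1 `^ s.
  move=> d0 Dd dD; exists 1%N.
    exists (fun=> E); split; last by move=> x Ex; exists ord0.
    move=> _; apply: diam_le (ltW d0) _ => x y /E_cube xc /E_cube yc.
    exact: le_trans (cube_edist xc yc) Dd.
  rewrite -powRM ?divr_ge0 ?invr_ge0 ?(ltW D0) ?(ltW lo0) ?(ltW d0)//.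
  by rewrite one_le_powR// ler_pdivlMr// mul1r.
elim=> [|k IH] d d0 kd dD; have [Dd|dltD] := leP D d;
  try exact: coarse.
  by move: kd; rewrite expr0 mulr1 leNgt dltD.
have /choice[m mP] : forall i, exists m, coverable (d / rho i) E m /\
    m%:R <= (D / lo) `^ s * (d / rho i)^-1 `^ s.
  move=> i; have /andP[loi ihi] := lohi i.
  have [||| m Em mle] := IH (d / rho i); last by exists m.
  - by rewrite divr_gt0.
  - rewrite ler_pdivlMr// (le_trans _ kd)// exprSr mulrA.
    by rewrite ler_wpM2l// mulr_ge0 ?exprn_ge0// ltW.
  - by rewrite ler_pM ?invr_ge0 ?(ltW d0) ?(ltW (rho0 i)) ?(ltW dltD)// lef_pV2 ?posrE.
exists (\sum_i m i)%N.
  rewrite E_self; apply: coverable_bigcup => i.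
  have := coverable_embed i (ltW (divr_gt0 d0 (rho0 i))) (mP i).1.
  by rewrite mulrC divfK// gt_eqF.
rewrite natr_sum; apply: (@le_trans _ _
    (\sum_i rho i `^ s * ((D / lo) `^ s * d^-1 `^ s))).
  apply: ler_sum => i _; apply: le_trans (mP i).2 _.
  rewrite invf_div (@powRM _ (rho i)) ?invr_ge0 ?(ltW d0) ?(ltW (rho0 i))//.
  by rewrite mulrCA.
by rewrite -mulr_suml moran mul1r.
Qed.

Variable x0 : 'rV[R]_n.
Hypothesis x0E : E x0.

(** The [m]-th approximation of the natural self-similar measure, which gives
    cube [i] the mass [rho i ^ s]: push the Dirac mass at a point of [E]
    forward [m] times. Being a finite sum of Dirac masses, it is defined on all
    sets, and no limit measure has to be constructed. *)
Fixpoint mass (m : nat) (A : set 'rV[R]_n) : R :=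
  if m is m'.+1 then \sum_i rho i `^ s * mass m' (embed l rho i @^-1` A)
  else (`[< A x0 >])%:R.

Lemma mass_le1 m A : mass m A <= 1.
Proof.
elim: m A => [|m IH] A /=; first by rewrite lern1 leq_b1.
rewrite -moran; apply: ler_sum => i _.
by rewrite ler_piMr ?powR_ge0.
Qed.

Lemma mass_support m A : E `<=` A -> mass m A = 1.
Proof.
elim: m A => [|m IH] A EA /=; first by rewrite asboolT//; exact: EA.
rewrite -moran; apply: eq_bigr => i _; rewrite IH ?mulr1// => x Ex.
by apply: EA; rewrite E_self; exists i => //; exists x.
Qed.

Lemma mass_outside m A : A `&` unit_cube = set0 -> mass m A = 0.
Proof.
elim: m A => [|m IH] A A0 /=.
  rewrite asboolF// => Ax; have : (A `&` unit_cube) x0 by split=> //; exact: E_cube.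
  by rewrite A0.
rewrite big1// => i _; rewrite IH ?mulr0//.
rewrite -subset0 => x [Ax xc]; have : (A `&` unit_cube) (embed l rho i x).
  by split=> //; exact: embed_in_cube.
by rewrite A0.
Qed.

Lemma mass_subadditive m A N (U : nat -> set 'rV[R]_n) :
  A `<=` \bigcup_(k in [set k | (k < N)%N]) U k ->
  mass m A <= \sum_(k < N) mass m (U k).
Proof.
elim: m A U => [|m IH] A U AU /=.
  have [Ax|nAx] := asboolP (A x0); last by apply: sumr_ge0.
  have [k /= kN Ux] := AU _ Ax.
  rewrite (bigD1 (Ordinal kN))//= asboolT// lerDl.
  by apply: sumr_ge0.
rewrite exchange_big/=; apply: ler_sum => i _; rewrite -mulr_sumr.
rewrite ler_wpM2l ?powR_ge0//.
by apply: (IH _ (fun k => embed l rho i @^-1` U k)) => x Ax; have := AU _ Ax.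
Qed.

Definition block (a : 'rV[R]_n) (d : R) : set 'rV[R]_n :=
  [set x | forall j, a 0 j <= x 0 j <= a 0 j + d].

Lemma preimage_block i a d : embed l rho i @^-1` block a d =
  block (\row_j ((a 0 j - l i 0 j) / rho i)) (d / rho i).
Proof.
apply/seteqP; split=> x /= xP j; have := xP j;
  rewrite !mxE -mulrDl ler_pdivrMr// ler_pdivlMr// => /andP[? ?];
  apply/andP; split; lra.
Qed.

Hypothesis packing : forall a b : 'rV[R]_n, (forall j, a 0 j <= b 0 j) ->
  \sum_i rho i ^+ n *
    \prod_j (local_coord l rho i j (b 0 j) - local_coord l rho i j (a 0 j))
  <= \prod_j (clamp (b 0 j) - clamp (a 0 j)).
Hypothesis s_le_n : s <= n%:R.

(** A block of side [d] has mass at most d^(s-n), up to a constant, times the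
    Lebesgue measure of its enlargement (by [d] on each side) within the cube.
    In this form the estimate is stable under the self-similarity: the masses
    [rho i ^ s] turn d^(s-n) at scale [d / rho i] into [rho i ^ n] times
    d^(s-n) at scale [d], and the parts of the enlarged block in the
    non-overlapping cubes have total measure at most the whole. The
    approximation of order [m] is accurate only down to scale [hi ^ m]. *)
Lemma mass_block_window lo hi m a d : 0 < lo ->
  (forall i, lo <= rho i <= hi) -> 0 < d -> hi ^+ m <= d -> d <= lo^-1 ->
  mass m (block a d) <= lo^-1 `^ (n%:R - s) * d^-1 `^ (n%:R - s) *
    \prod_j (clamp (a 0 j + 2 * d) - clamp (a 0 j - d)).
Proof.
move=> lo0 lohi; have b0 : 0 <= n%:R - s by rewrite subr_ge0.
move: m a d.
(* at scales above 1 the enlarged block covers the cube or misses it *)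
have coarse m a d : 0 < d -> 1 <= d -> d <= lo^-1 ->
    mass m (block a d) <= lo^-1 `^ (n%:R - s) * d^-1 `^ (n%:R - s) *
      \prod_j (clamp (a 0 j + 2 * d) - clamp (a 0 j - d)).
  move=> d0 d1 dlo.
  have [A0|/eqP/set0P[y [yb yc]]] := pselect (block a d `&` unit_cube = set0).
    rewrite mass_outside// !mulr_ge0 ?powR_ge0// prodr_ge0// => j _.
    by rewrite subr_ge0; apply: clamp_homo; lra.
  rewrite big1 ?mulr1 => [|j _].
    apply: le_trans (mass_le1 _ _) _.
    rewrite -powRM ?invr_ge0 ?(ltW d0) ?(ltW lo0)//.
    by rewrite one_le_powR// ler_pdivlMr// mul1r.
  have := yb j; have := yc j => ? ?.
  by rewrite clamp_eq1 ?clamp_eq0 ?subr0//; lra.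
elim=> [|m IH] a d d0 md dlo; have [d1|d1] := leP 1 d;
  try exact: coarse.
rewrite /=; under eq_bigr do rewrite preimage_block.
pose c := lo^-1 `^ (n%:R - s) * d^-1 `^ (n%:R - s).
pose V i := \prod_j (local_coord l rho i j (a 0 j + 2 * d) -
                     local_coord l rho i j (a 0 j - d)).
apply: (@le_trans _ _ (\sum_i c * (rho i ^+ n * V i))).
  apply: ler_sum => i _; have /andP[loi ihi] := lohi i.
  have di0 : 0 < d / rho i by rewrite divr_gt0.
  apply: (@le_trans _ _ (rho i `^ s * (lo^-1 `^ (n%:R - s) *
      (d / rho i)^-1 `^ (n%:R - s) * V i))).
    rewrite ler_wpM2l ?powR_ge0//; apply: le_trans (IH _ _ di0 _ _) _.
    - rewrite ler_pdivlMr// (le_trans _ md)// exprSr ler_wpM2l//.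
      by rewrite exprn_ge0// (le_trans (ltW (rho0 i))).
    - rewrite ler_pdivrMr//; apply: (le_trans (ltW d1)).
      by rewrite mulrC ler_pdivlMr// mul1r.
    - rewrite le_eqVlt; apply/orP; left; apply/eqP; congr (_ * _).
      apply: eq_bigr => j _; rewrite !mxE /local_coord.
      by congr (clamp _ - clamp _); field; rewrite gt_eqF.
  rewrite invf_div powRM ?invr_ge0 ?(ltW d0) ?(ltW (rho0 i))//.
  rewrite le_eqVlt; apply/orP; left; apply/eqP.
  rewrite (_ : rho i ^+ n = rho i `^ s * rho i `^ (n%:R - s)).
    by rewrite /c; ring.
  rewrite -powRD ?(gt_eqF (rho0 i)) ?implybT// addrC subrK powR_mulrn//.
  by rewrite ltW.
rewrite -mulr_sumr ler_wpM2l ?mulr_ge0 ?powR_ge0//.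
pose a' : 'rV[R]_n := \row_j (a 0 j - d).
pose b' : 'rV[R]_n := \row_j (a 0 j + 2 * d).
rewrite (eq_bigr (fun i => rho i ^+ n * \prod_j
    (local_coord l rho i j (b' 0 j) - local_coord l rho i j (a' 0 j)))); last first.
  by move=> i _; congr (_ * _); apply: eq_bigr => j _; rewrite !mxE.
rewrite [leRHS](eq_bigr (fun j => clamp (b' 0 j) - clamp (a' 0 j))); last first.
  by move=> j _; rewrite !mxE.
by apply: packing => j; rewrite !mxE; lra.
Qed.

Lemma mass_block lo hi m a d : 0 < lo <= 1 ->
  (forall i, lo <= rho i <= hi) -> 0 < d <= 1 -> hi ^+ m <= d ->
  mass m (block a d) <= lo^-1 `^ (n%:R - s) * 3 ^+ n * d `^ s.
Proof.
move=> /andP[lo0 lo1] lohi /andP[d0 d1] md.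
apply: le_trans (mass_block_window a lo0 lohi d0 md _) _.
  by rewrite (le_trans d1)// invf_ge1.
apply: (@le_trans _ _ (lo^-1 `^ (n%:R - s) * d^-1 `^ (n%:R - s) * (3 * d) ^+ n)).
  rewrite ler_wpM2l ?mulr_ge0 ?powR_ge0//.
  rewrite -[X in _ <= _ ^+ X](card_ord n) -prodr_const; apply: ler_prod => j _.
  have ad : a 0 j - d <= a 0 j + 2 * d by lra.
  have := clamp_homo ad; have := clamp_increment ad.
  by rewrite subr_ge0; lra.
rewrite le_eqVlt; apply/orP; left; apply/eqP.
have -> : d^-1 `^ (n%:R - s) = d `^ (s - n%:R).
  by rewrite -(powR_inv1 (ltW d0)) -powRrM mulN1r opprB.
rewrite exprMn -(powR_mulrn n (ltW d0)).
have -> : d `^ s = d `^ (s - n%:R) * d `^ n%:R.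
  by rewrite -powRD ?subrK ?(gt_eqF d0) ?implybT.
by rewrite -!mulrA; congr (_ * _); rewrite mulrCA.
Qed.

Hypothesis E_closed : closed E.
Hypothesis s_ge1 : 1 <= s.

Lemma compact_E : compact E.
Proof.
have cpt := @rV_compact R n (fun=> `[0, 1]%classic)
  (fun=> @segment_compact R 0 1).
apply: subclosed_compact E_closed cpt _ => x /E_cube xc i.
by rewrite /= in_itv/=; exact: xc.
Qed.

(** The mass distribution principle. The sets of a countable cover are replaced
    by slightly larger balls, with radii increased by a geometric sequence so
    small that the total cost grows by at most a fixed fraction of the bound;
    by compactness finitely many of them suffice, and an approximate measure
    of high enough order then bounds the cost from below. *)
Lemma content_positive_self_similar : content_positive s E.
Proof.
have [lo [hi [lo01 hi01 lohi]]] := side_bounds.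
have /andP[lo0 lo1] := lo01.
pose K := lo^-1 `^ (n%:R - s) * 3 ^+ n * (2 `^ s * 2 `^ s).
have K0 : 0 < K by rewrite !mulr_gt0 ?powR_gt0 ?invr_gt0 ?exprn_gt0.
(* [e] bounds the total enlargement; the first bound keeps all sides at most
   1, the second halves the final estimate. *)
pose e := Num.min 4^-1 (2 * K)^-1.
have e0 : 0 < e by rewrite lt_min !invr_gt0 mulr_gt0 ?ltr0n.
have e4 : e <= 4^-1 by rewrite ge_min lexx.
have eK : e <= (2 * K)^-1 by rewrite ge_min lexx orbT.
exists (2 * K)^-1; first by rewrite invr_gt0 mulr_gt0.
move=> U U4 EU.
have /choice[d dP] : forall k, exists d : R, 0 <= d <= 4^-1 /\ diam (U k) = d%:E.
  by move=> k; have [d ? ?] := diam_fin (U4 k); exists d.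
pose eta k : R := e / 2 ^+ k.+1.
have eta0 k : 0 < eta k by rewrite divr_gt0 ?exprn_gt0.
have eta_e k : eta k <= e.
  by rewrite ler_pdivrMr ?exprn_gt0// ler_peMr ?(ltW e0)// exprn_ege1// ler1n.
have /choice[c cP] : forall k, exists c : 'rV[R]_n, U k `<=` ball c (d k + eta k).
  move=> k; have [U0|/eqP/set0P[c Uc]] := pselect (U k = set0).
    by exists 0; rewrite U0.
  have [/andP[d0 _] dE] := dP k.
  exists c => x Ux; split; first by rewrite ltr_wpDl.
  move=> i j; rewrite (ord1 i) /ball/=.
  have := le_diam Uc Ux; rewrite dE lee_fin => /(le_trans (coord_le_edist _ _ j)).
  by move=> /le_lt_trans; apply; rewrite ltrDl.
have [D _ DE] : finite_subset_cover [set: nat] (fun k => ball (c k) (d k + eta k)) E.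
  have := compact_E; rewrite compact_cover; apply.
    by move=> k _; exact: ball_open.
  by move=> x /EU[k _ Ukx]; exists k => //; exact: cP.
pose N := (\max_(k <- finmap.enum_fset D) k).+1.
pose w k := 2 * (d k + eta k).
have wP k : eta k <= w k <= 1.
  by rewrite /w; have := eta_e k; have := eta0 k; case: (dP k) => *; lra.
pose V k := block (\row_j (c k 0 j - (d k + eta k))) (w k).
have EV : E `<=` \bigcup_(k in [set k | (k < N)%N]) V k.
  move=> x /DE[k /= kD [_ xk]]; exists k.
    by rewrite /= ltnS (big_rem k kD)/= leq_maxl.
  move=> j; have := xk 0 j; rewrite /ball/= ltr_distlC !mxE /w.
  by move=> /andP[? ?]; apply/andP; split; lra.
(* all the finitely many sides are at least [eta N] *)
have [m mN] := exists_exp_le hi01 (eta0 N).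
have Vle k : (k < N)%N -> mass m (V k) <= K * (d k `^ s + eta k).
  move=> kN; have /andP[ew w1] := wP k.
  have w0 : 0 < w k := lt_le_trans (eta0 k) ew.
  have hw : hi ^+ m <= w k.
    apply: le_trans mN (le_trans _ ew); rewrite ler_pM2l// lef_pV2 ?posrE ?exprn_gt0//.
    by rewrite ler_eXn2l ?ltr1n// ltnS ltnW.
  apply: le_trans (@mass_block lo hi m _ (w k) lo01 lohi _ hw) _; first by rewrite w0.
  rewrite /K -2!mulrA -[leRHS]mulrA; do 2 rewrite ler_wpM2l ?powR_ge0 ?exprn_ge0//.
  have [/andP[d0 _] _] := dP k.
  rewrite powRM ?addr_ge0 ?(ltW (eta0 k))// -mulrA ler_wpM2l ?powR_ge0//.
  apply: le_trans (powR_add_le s_ge0 d0 (ltW (eta0 k))) _.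
  rewrite ler_wpM2l ?powR_ge0// lerD2l ge1r_powR// eta0/=.
  by have := eta_e k; lra.
have etaS M : \sum_(k < M) eta k <= e * (1 - 2^-1 ^+ M).
  elim: M => [|M IH]; first by rewrite big_ord0 expr0 subrr mulr0.
  rewrite big_ord_recr/= (le_trans (lerD IH (lexx _)))// /eta -exprVn !exprS.
  by rewrite le_eqVlt; apply/orP; left; apply/eqP; field.
have etaSe M : \sum_(k < M) eta k <= e.
  apply: le_trans (etaS M) _; rewrite ler_piMr ?(ltW e0)//.
have real_bound : (2 * K)^-1 <= \sum_(k < N) d k `^ s.
  have : 1 <= K * (\sum_(k < N) d k `^ s + e).
    rewrite -(mass_support m (fun x (Ex : E x) => Ex)).
    apply: le_trans (mass_subadditive m EV) _.
    apply: le_trans (ler_sum _ (fun k _ => Vle _ (ltn_ord k))) _.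
    by rewrite -mulr_sumr big_split/= ler_wpM2l ?(ltW K0)// lerD2l etaSe.
  rewrite mulrC -ler_pdivrMr// div1r => h.
  have KK : K^-1 = (2 * K)^-1 + (2 * K)^-1 by field; rewrite gt_eqF.
  by lra.
apply: (@le_trans _ _ (\sum_(0 <= k < N) diam_pow s (U k))%E); last first.
  by apply: nneseries_lim_ge => k *; exact: diam_pow_ge0.
rewrite big_mkord (eq_bigr (fun k : 'I_N => (d k `^ s)%:E)).
  by rewrite sumEFin lee_fin.
move=> k _; rewrite /diam_pow; case: eqP => [U0|_].
  have [/andP[d0 _]] := dP k.
  rewrite U0 => dE; rewrite (_ : d k = 0).
    by rewrite powR0// gt_eqF// (lt_le_trans ltr01).
  apply/le_anti; rewrite d0 andbT -lee_fin -dE; exact: diam_set0_le.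
by rewrite (dP k).2 poweR_EFin.
Qed.

End Dimension.

(** * The side length solving Moran's equation *)

Section SideLength.
Context {R : realType}.

(** The intermediate value theorem between [e = 3 ^ (- n / (s - 1))], where the
    first term of the sum is [e] and the second at most [1 - 3 * e], and
    [b = 3 ^ (- n / s)], where the first term is 1. The first choice needs
    [1 < s], and [b < 1 / 3] needs [s < n]. *)
Lemma side_length_exists (n : nat) (s : R) : 1 < s -> s < n%:R ->
  exists r : R, [/\ 0 < r, 3 * r < 1 & 3 ^+ n * r `^ s + (1 - 3 * r) `^ s = 1].
Proof.
move=> s1 sn; have s0 : 0 < s by lra.
have n0 : (0 : R) < n%:R by lra.
pose e : R := 3 `^ (- (n%:R / (s - 1))); pose b : R := 3 `^ (- (n%:R / s)).
have e0 : 0 < e by rewrite powR_gt0.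
have b0 : 0 < b by rewrite powR_gt0.
have eb : e <= b.
  rewrite ler_powR ?ler1n// lerN2 ler_wpM2l ?(ltW n0)// lef_pV2 ?posrE; lra.
have b3 : 3 * b < 1.
  rewrite -[X in X * b](powRr1 (ler0n R 3)) -powRD ?implybT//; last first.
    by rewrite pnatr_eq0 implybT.
  rewrite -[ltRHS](powRr0 (3 : R)) /powR pnatr_eq0/= ltr_expR ltr_pM2r.
    by rewrite subr_lt0 ltr_pdivlMr// mul1r.
  by rewrite ln_gt0// ltr1n.
pose g x : R := 3 ^+ n * x `^ s + (1 - 3 * x) `^ s.
have gc : {within `[e, b], continuous g}.
  apply: continuous_in_subspaceT => x; rewrite inE/= in_itv/= => /andP[ex xb].
  have x0 : 0 < x := lt_le_trans e0 ex.
  apply: cvgD; first by apply: cvgMl_tmp; exact: continuous_powR.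
  have affine : {for x, continuous (fun x : R => 1 - 3 * x)}.
    by apply: cvgB; [exact: cvg_cst|apply: cvgMl_tmp; exact: cvg_id].
  apply: (@continuous_comp _ _ _ (fun x : R => 1 - 3 * x) (fun y => y `^ s)) => //.
  by apply: continuous_powR; lra.
have ge1 : g e <= 1.
  have -> : g e = e + (1 - 3 * e) `^ s.
    rewrite /g; congr (_ + _).
    rewrite -{1}(subrK 1 s) powRD ?(gt_eqF e0) ?implybT// powRr1 ?(ltW e0)// mulrA.
    rewrite /e -powRrM mulNr divfK ?subr_eq0 ?gt_eqF// powRN powR_mulrn//.
    by rewrite divff ?mul1r// expf_neq0// pnatr_eq0.
  have : (1 - 3 * e) `^ s <= 1 - 3 * e by apply: ge1r_powR; [lra|exact: ltW].
  lra.
have gb1 : 1 <= g b.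
  rewrite /g /b -powRrM mulNr divfK ?gt_eqF// powRN powR_mulrn//.
  by rewrite divff ?expf_neq0 ?pnatr_eq0// lerDl powR_ge0.
have ends : Num.min (g e) (g b) <= 1 <= Num.max (g e) (g b).
  move: (g e) (g b) ge1 gb1 => ge gb ge1 gb1.
  by rewrite ge_min ge1 le_max gb1 orbT.
have [c] := IVT eb gc ends.
rewrite in_itv/= => /andP[ec cb] gc1; exists c; split=> //.
  exact: lt_le_trans e0 ec.
by apply: le_lt_trans b3; rewrite ler_pM2l.
Qed.

End SideLength.

(** * The grid of cubes and its two systems of weights *)

Section Grid.
Context {R : realType} {n : nat}.
Variables (r : R) (p0 p1 : 'I_n).
Hypothesis r_gt0 : 0 < r.
Hypothesis r_lt : 3 * r < 1.

Definition digits := {ffun 'I_n -> 'I_3}.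

(** Each axis is cut into three intervals of length [r] and a last one of
    length [1 - 3 * r]. The cells are the [3 ^ n] cubes of side [r] in
    [[0, 3 r]^n], indexed by their digits, and [None] for [[3 r, 1]^n]. *)
Definition corner (i : option digits) : 'rV[R]_n :=
  \row_j (if i is Some d then r * (d j)%:R else 3 * r).

Definition side (i : option digits) : R := if i is Some _ then r else 1 - 3 * r.

Definition digit_coord (e : 'I_3) (x : R) : R := clamp ((x - r * e%:R) / r).

Definition last_coord (x : R) : R := clamp ((x - 3 * r) / (1 - 3 * r)).

Lemma local_coord_digit d j x :
  local_coord corner side (Some d) j x = digit_coord (d j) x.
Proof. by rewrite /local_coord mxE. Qed.

Lemma local_coord_last j x : local_coord corner side None j x = last_coord x.
Proof. by rewrite /local_coord mxE. Qed.

Lemma digit_le2 (e : 'I_3) : (e%:R : R) <= 2.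
Proof. by rewrite ler_nat -ltnS. Qed.

Lemma grid_cells : cell_system corner side.
Proof.
have r0 := r_gt0; have r3 := r_lt.
split.
- by case=> [d|]; [exact: r_gt0|rewrite subr_gt0].
- have r1 : r < 1 by lra.
  by case=> [d|]; [exact: r1|rewrite gtrBl mulr_gt0].
- by case=> [d|] j; rewrite mxE mulr_ge0// ltW.
- case=> [d|] j; rewrite mxE/=; last by rewrite addrC subrK.
  apply: le_trans (ltW r_lt).
  have : r * (d j)%:R <= r * 2 by rewrite ler_pM2l// digit_le2.
  lra.
- move=> [d|] [d'|] //= dd'.
  + have [j dj] : exists j, d j != d' j.
      apply/existsP; rewrite -[X in is_true X]negbK negb_exists.
      apply: contra dd' => /forallP/= H; apply/eqP; congr Some.
      by apply/ffunP => j; apply/eqP; have := H j; rewrite negbK.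
    exists j; rewrite !mxE; move: dj; rewrite -val_eqE neq_ltn/=.
    have step (k k' : nat) : (k < k')%N -> r * k%:R + r <= r * k'%:R.
      move=> kk; rewrite -[X in _ + X]mulr1 -mulrDr ler_pM2l//.
      by rewrite natr1 ler_nat.
    by case/orP => /step; [left|right].
  + exists p0; left; rewrite !mxE.
    have : r * (d p0)%:R <= r * 2 by rewrite ler_pM2l// digit_le2.
    rewrite /side; lra.
  + exists p0; right; rewrite !mxE.
    have : r * (d' p0)%:R <= r * 2 by rewrite ler_pM2l// digit_le2.
    rewrite /side; lra.
Qed.

Lemma scaled_coord_le (a c x : R) : 0 < c -> x <= a -> c * clamp ((x - a) / c) = 0.
Proof.
by move=> c0 xa; rewrite clamp_eq0 ?mulr0// pmulr_lle0 ?invr_gt0// subr_le0.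
Qed.

Lemma scaled_coord_ge (a c x : R) : 0 < c -> a + c <= x ->
  c * clamp ((x - a) / c) = c.
Proof.
by move=> c0 xa; rewrite clamp_eq1 ?mulr1// ler_pdivlMr// mul1r lerBrDl.
Qed.

Lemma scaled_coord_in (a c x : R) : 0 < c -> a <= x <= a + c ->
  c * clamp ((x - a) / c) = x - a.
Proof.
move=> c0 /andP[ax xc]; rewrite clamp_id; first by field; rewrite gt_eqF.
by rewrite divr_ge0 ?subr_ge0 ?(ltW c0)//= ler_pdivrMr// mul1r lerBlDl.
Qed.

(** On every axis the interval lengths fill [0, 1], which is behind both the
    uniform margins and the packing inequality. *)
Lemma grid_partition x :
  r * (\sum_e digit_coord e x) + (1 - 3 * r) * last_coord x = clamp x.
Proof.
have r0 := r_gt0; have r3 := r_lt.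
rewrite mulr_sumr !big_ord_recl big_ord0/= /digit_coord /last_coord/=.
have -> : bump 0 (bump 0 0) = 2 by [].
have -> : bump 0 0 = 1 by [].
rewrite mulr0 mulr1 addr0.
have q0 : 0 < 1 - 3 * r by rewrite subr_gt0.
have [x0|x0] := leP x 0.
  by rewrite !scaled_coord_le// ?clamp_eq0//; lra.
have [xr|xr] := leP x r.
  by rewrite (@scaled_coord_in 0)// ?scaled_coord_le// ?clamp_id//; lra.
have [x2|x2] := leP x (2 * r).
  rewrite (@scaled_coord_ge 0)//; last lra.
  rewrite (@scaled_coord_in r)//; last lra.
  by rewrite !scaled_coord_le// ?clamp_id//; lra.
have [x3|x3] := leP x (3 * r).
  rewrite (@scaled_coord_ge 0)//; last lra.
  rewrite (@scaled_coord_ge r)//; last lra.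
  rewrite (@scaled_coord_in (r * 2))//; last lra.
  by rewrite !scaled_coord_le// ?clamp_id//; lra.
rewrite (@scaled_coord_ge 0)//; last lra.
rewrite (@scaled_coord_ge r)//; last lra.
rewrite (@scaled_coord_ge (r * 2))//; last lra.
have [x1|x1] := leP x 1.
  by rewrite scaled_coord_in// ?clamp_id//; lra.
by rewrite scaled_coord_ge// ?clamp_eq1//; lra.
Qed.

Lemma digit_coord_homo e : {homo digit_coord e : x y / x <= y}.
Proof.
by move=> x y xy; apply: clamp_homo; rewrite ler_pM2r ?invr_gt0// lerB.
Qed.

Lemma last_coord_homo : {homo last_coord : x y / x <= y}.
Proof.
move=> x y xy; apply: clamp_homo; rewrite ler_pM2r ?invr_gt0 ?subr_gt0//.
exact: lerB.
Qed.

Lemma digit_coord_antitone (e e' : 'I_3) x : (e <= e')%N ->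
  digit_coord e' x <= digit_coord e x.
Proof.
move=> ee; apply: clamp_homo; rewrite ler_pM2r ?invr_gt0// lerB//.
by rewrite ler_pM2l// ler_nat.
Qed.

Lemma sum_cells (F : option digits -> R) :
  \sum_i F i = F None + \sum_d F (Some d).
Proof.
rewrite (bigD1 None)//=; congr (_ + _).
rewrite (reindex_omap Some id)/=; last by case.
by apply: eq_bigl => d; rewrite eqxx.
Qed.

Lemma sum_digits_prod (F : 'I_n -> 'I_3 -> R) :
  \sum_(d : digits) \prod_j F j (d j) = \prod_j \sum_e F j e.
Proof. by rewrite bigA_distr_bigA. Qed.

Lemma prod_add_le (x y : 'I_n -> R) : (forall j, 0 <= x j) ->
  (forall j, 0 <= y j) ->
  \prod_j x j + \prod_j y j <= \prod_j (x j + y j).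
Proof.
move=> x0 y0; rewrite (bigD1 p0)//= [X in _ + X <= _](bigD1 p0)//= [leRHS](bigD1 p0)//= mulrDl.
apply: lerD; rewrite ler_wpM2l// ler_prod// => j _; rewrite ?x0 ?y0/=.
  by rewrite lerDl.
by rewrite lerDr.
Qed.

(** The small cubes fill [[0, 3 r]^n], so the left-hand side is the Lebesgue
    measure of the part of a box lying in [[0, 3 r]^n] or in [[3 r, 1]^n]. *)
Lemma grid_packing (a b : 'rV[R]_n) : (forall j, a 0 j <= b 0 j) ->
  \sum_i side i ^+ n * \prod_j (local_coord corner side i j (b 0 j) -
                                local_coord corner side i j (a 0 j))
  <= \prod_j (clamp (b 0 j) - clamp (a 0 j)).
Proof.
move=> ab; rewrite sum_cells/=.
pose x j := \sum_e r * (digit_coord e (b 0 j) - digit_coord e (a 0 j)).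
pose y j := (1 - 3 * r) * (last_coord (b 0 j) - last_coord (a 0 j)).
have -> : \prod_j (clamp (b 0 j) - clamp (a 0 j)) = \prod_j (x j + y j).
  apply: eq_bigr => j _; rewrite -!grid_partition /x /y -mulr_sumr sumrB.
  by ring.
apply: le_trans (prod_add_le _ _); last 2 first.
- move=> j; apply: sumr_ge0 => e _; rewrite mulr_ge0 ?(ltW r_gt0)// subr_ge0.
  exact: digit_coord_homo.
- move=> j; rewrite mulr_ge0 ?subr_ge0 ?(ltW r_lt)//.
  exact: last_coord_homo.
rewrite addrC; apply: lerD.
  rewrite le_eqVlt; apply/orP; left; apply/eqP.
  rewrite -sum_digits_prod; apply: eq_bigr => d _.
  rewrite big_split/= prodr_const card_ord; congr (_ * _).
  by apply: eq_bigr => j _; rewrite !local_coord_digit.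
rewrite big_split/= prodr_const card_ord.
by under eq_bigr do rewrite !local_coord_last.
Qed.

Lemma grid_moran s : 3 ^+ n * r `^ s + (1 - 3 * r) `^ s = 1 ->
  \sum_i side i `^ s = 1.
Proof.
move=> <-; rewrite sum_cells/= addrC; congr (_ + _).
by rewrite sumr_const card_ffun !card_ord -natrX mulr_natl.
Qed.

Lemma sum_digit (G : 'I_3 -> R) j :
  3 * \sum_(d : digits) G (d j) = 3 ^+ n * \sum_e G e.
Proof.
pose F i e := if i == j then G e else 1.
have -> : \sum_(d : digits) G (d j) = \sum_(d : digits) \prod_i F i (d i).
  apply: eq_bigr => d _; rewrite (bigD1 j)//= big1 ?mulr1 /F ?eqxx// => i /negPf.
  by move=> ->.
have -> : 3 ^+ n = 3 * \prod_(i < n | i != j) (3 : R).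
  by rewrite -[n in LHS]card_ord -prodr_const (bigD1 j).
rewrite sum_digits_prod (bigD1 j)//=.
rewrite [X in _ * (_ * X)](eq_bigr (fun=> 3)) => [|i /negPf ij].
  by rewrite /F eqxx; ring.
by rewrite /F ij sumr_const card_ord.
Qed.

Definition uniform_weight (i : option digits) : R :=
  if i is Some _ then 3 * r / 3 ^+ n else 1 - 3 * r.

(** A function of mean zero on the digits: multiplying the masses of the small
    cubes by [1 - bump_digit (d p0) * bump_digit (d p1) / 3] leaves the mass of
    every slab unchanged. The factor is [2/3] when neither digit is central,
    [5/3] when one of them is, and [-1/3] when both are. *)
Definition bump_digit (e : 'I_3) : R := if e == 1 :> nat then -2 else 1.

Definition signed_weight (i : option digits) : R :=
  if i is Some d then
    3 * r / 3 ^+ n * (1 - bump_digit (d p0) * bump_digit (d p1) / 3)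
  else 1 - 3 * r.

Hypothesis p01 : p0 != p1.

Lemma small_weight_gt0 : 0 < 3 * r / 3 ^+ n.
Proof. by rewrite divr_gt0 ?exprn_gt0// mulr_gt0. Qed.

(** One of [p0] and [p1] differs from [j], and the sum over the digit in that
    position vanishes. *)
Lemma sum_bump_digit (G : 'I_3 -> R) j :
  \sum_(d : digits) bump_digit (d p0) * bump_digit (d p1) * G (d j) = 0.
Proof.
pose F i e := (if i == p0 then bump_digit e else 1) *
  (if i == p1 then bump_digit e else 1) * (if i == j then G e else 1).
rewrite (eq_bigr (fun d : digits => \prod_i F i (d i))); last first.
  by move=> d _; rewrite !big_split/= -!big_mkcond/= !big_pred1_eq.
rewrite sum_digits_prod.
have [p [pj pF]] : exists p, p != j /\ forall e, p != j -> F p e = bump_digit e.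
  have [j0|j0] := eqVneq p0 j.
    exists p1; rewrite -j0 eq_sym p01; split=> // e _.
    by rewrite /F -j0 eqxx eq_sym (negPf p01) mul1r mulr1.
  by exists p0; split=> // e _; rewrite /F eqxx (negPf j0) (negPf p01) !mulr1.
rewrite (bigD1 p)//= (_ : \sum_e _ = 0) ?mul0r//.
rewrite (eq_bigr bump_digit) => [|e _]; last exact: pF.
by rewrite !big_ord_recl big_ord0 /bump_digit/=; lra.
Qed.

Lemma uniform_weight_marginal : marginal_weights corner side uniform_weight.
Proof.
move=> j x; rewrite sum_cells/= local_coord_last -mulr_sumr.
under eq_bigr do rewrite local_coord_digit.
rewrite -grid_partition addrC; congr (_ + _).
have := sum_digit (digit_coord ^~ x) j => h.
rewrite -!mulrA; have n3 : (3 ^+ n : R) != 0 by rewrite expf_neq0// pnatr_eq0.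
have -> : 3 * (r * ((3 ^+ n)^-1 * \sum_(d : digits) digit_coord (d j) x)) =
    r / 3 ^+ n * (3 * \sum_(d : digits) digit_coord (d j) x) by ring.
by rewrite h mulrA divfK.
Qed.

Lemma signed_weight_marginal : marginal_weights corner side signed_weight.
Proof.
move=> j x; rewrite -(uniform_weight_marginal j) !sum_cells/=; congr (_ + _).
under eq_bigr do rewrite mulrBr mulr1 mulrBl.
rewrite sumrB [X in _ - X](_ : _ = 0) ?subr0//.
rewrite (eq_bigr (fun d : digits => (r / 3 ^+ n) *
  (bump_digit (d p0) * bump_digit (d p1) * digit_coord (d j) x))).
  by rewrite -mulr_sumr (sum_bump_digit (digit_coord ^~ x)) mulr0.
by move=> d _; rewrite local_coord_digit; field; rewrite expf_neq0 ?pnatr_eq0.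
Qed.

Lemma uniform_weight_gt0 i : 0 < uniform_weight i.
Proof. by case: i => [d|]; [exact: small_weight_gt0|rewrite /= subr_gt0]. Qed.

(** The small cubes that receive a negative mass. *)
Definition central (d : digits) := (d p0 == 1 :> nat) && (d p1 == 1 :> nat).

Lemma sign_factor_central d : central d ->
  1 - bump_digit (d p0) * bump_digit (d p1) / 3 = - 3^-1.
Proof. by rewrite /bump_digit => /andP[-> ->]; lra. Qed.

Lemma sign_factor_noncentral d : ~~ central d ->
  3^-1 <= 1 - bump_digit (d p0) * bump_digit (d p1) / 3.
Proof. by rewrite /central /bump_digit; case: eqP; case: eqP => //= *; lra. Qed.

Lemma signed_weight_neq0 i : signed_weight i != 0.
Proof.
case: i => [d|] /=; last by rewrite gt_eqF// subr_gt0.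
apply: mulf_neq0; first by rewrite gt_eqF// small_weight_gt0.
have [dc|dc] := boolP (central d); first by rewrite sign_factor_central// oppr_eq0 invr_eq0 pnatr_eq0.
by rewrite gt_eqF// (lt_le_trans _ (sign_factor_noncentral dc)).
Qed.

Definition set_digit (d : digits) p e : digits :=
  [ffun i => if i == p then e else d i].

(** The negative term of a central cube, of factor [-1/3], is compensated by the
    term of the cube obtained by changing the digit in position [p], of factor
    at least [1/3]. *)
Lemma signed_sum_ge0 (X : digits -> R) p (e : 'I_3) :
  (p == p0) || (p == p1) -> e != 1 :> nat ->
  (forall d, 0 <= X d) -> (forall d, central d -> X d <= X (set_digit d p e)) ->
  0 <= \sum_(d : digits) (1 - bump_digit (d p0) * bump_digit (d p1) / 3) * X d.
Proof.
move=> pp e1 X0 Xc; pose one : 'I_3 := inord 1.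
have one1 : one = 1 :> nat by rewrite inordK.
rewrite (bigID central)/=.
have h1 : \sum_(d | central d) X d <= \sum_(d | ~~ central d) X d.
  apply: le_trans (ler_sum _ Xc) _.
  rewrite [leRHS](bigID (fun d => central (set_digit d p one) && (d p == e)))/=.
  rewrite -[leLHS]addr0 lerD ?sumr_ge0//.
  rewrite [leRHS](reindex_onto (fun d => set_digit d p e)
                               (fun d => set_digit d p one))/=; last first.
    move=> d /and3P[_ _ /eqP dp]; apply/ffunP => i; rewrite !ffunE.
    by case: eqP => // ->.
  rewrite le_eqVlt; apply/orP; left; apply/eqP; apply: eq_bigl => d.
  have -> : set_digit (set_digit d p e) p one = set_digit d p one.
    by apply/ffunP => i; rewrite !ffunE; case: eqP.
  have -> : set_digit d p e p == e by rewrite ffunE eqxx.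
  have -> : ~~ central (set_digit d p e).
    by rewrite /central !ffunE; case/orP: pp => /eqP->; rewrite eqxx (negPf e1) ?andbF.
  rewrite andbT/=; apply/idP/andP => [dc|[dc /eqP <-//]].
  have dE : set_digit d p one = d.
    apply/ffunP => i; rewrite !ffunE; case: eqP => // ->; apply/val_inj.
    by rewrite /= one1; case/andP: dc => /eqP d0 /eqP d1; case/orP: pp => /eqP->.
  by rewrite dE eqxx.
have h2 : \sum_(d | central d) (1 - bump_digit (d p0) * bump_digit (d p1) / 3) * X d
    = - 3^-1 * \sum_(d | central d) X d.
  by rewrite mulr_sumr; apply: eq_bigr => d /sign_factor_central ->.
have h3 : 3^-1 * \sum_(d | ~~ central d) X d <=
    \sum_(d | ~~ central d) (1 - bump_digit (d p0) * bump_digit (d p1) / 3) * X d.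
  rewrite mulr_sumr; apply: ler_sum => d /sign_factor_noncentral ?.
  by rewrite ler_wpM2r.
by rewrite h2; lra.
Qed.

Lemma localize_set_digit d p e u : localize corner side (Some (set_digit d p e)) u =
  upd (localize corner side (Some d) u) p (digit_coord e (u 0 p)).
Proof.
apply/rowP => i; rewrite !mxE local_coord_digit ffunE.
by case: eqP => [->//|_]; rewrite local_coord_digit.
Qed.

Lemma set_digit_id d p : set_digit d p (d p) = d.
Proof. by apply/ffunP => i; rewrite ffunE; case: eqP => [->|]. Qed.

(** The local coordinate along axis [p] decreases with the digit, and
    supermodularity says that increments in direction [j] grow with it. *)
Lemma digit_increment_antitone f u j x y d p (e e' : 'I_3) :
  supermodular f -> p != j -> x <= y -> (e <= e')%N ->
  let X d := f (localize corner side (Some d) (upd u j y)) -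
             f (localize corner side (Some d) (upd u j x)) in
  X (set_digit d p e') <= X (set_digit d p e).
Proof.
move=> fs pj xy ee /=; rewrite !localize_set_digit !localize_upd !mxE (negPf pj).
have jp : j != p by rewrite eq_sym.
apply: fs => //; last exact: digit_coord_antitone.
by rewrite !local_coord_digit; exact: digit_coord_homo.
Qed.

Lemma set_digit_central d p : (p == p0) || (p == p1) -> central d ->
  set_digit d p (inord 1) = d.
Proof.
move=> pp dc; rewrite -[RHS](set_digit_id d p); congr set_digit.
apply/val_inj; rewrite /= inordK//.
by case/andP: dc => /eqP d0 /eqP d1; case/orP: pp => /eqP->.
Qed.

(** Within a slab orthogonal to axis [j], move away from a negative cube along
    an axis [p != j] among [p0] and [p1]. Towards digit 0 the increments of [f]
    become larger, so the sum stays nonnegative. Towards digit 2 their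
    deficits to the largest possible increment become larger, so the sum
    does not exceed that of the full increments. *)
Lemma tame_increments_signed f : copula_like f ->
  tame_increments (transform corner side signed_weight f).
Proof.
move=> [f0 fm ft fs] u j x y xy.
have [p pp pj] : exists2 p, (p == p0) || (p == p1) & p != j.
  have [j0|j0] := eqVneq p0 j; last by exists p0; rewrite ?eqxx.
  by exists p1; rewrite ?eqxx ?orbT// -j0 eq_sym.
pose X i := f (localize corner side i (upd u j y)) -
            f (localize corner side i (upd u j x)).
pose L i := local_coord corner side i j y - local_coord corner side i j x.
have XL i : 0 <= X i <= L i.
  have := ft (localize corner side i u) j _ _ (local_coord_homo grid_cells i j xy).
  by rewrite !clamp_local_coord -!localize_upd.
have -> : transform corner side signed_weight f (upd u j y) -
    transform corner side signed_weight f (upd u j x) = \sum_i signed_weight i * X i.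
  by rewrite /transform -sumrB; apply: eq_bigr => i _; rewrite mulrBr.
have -> : clamp y - clamp x = \sum_i signed_weight i * L i.
  rewrite -!(signed_weight_marginal j) -sumrB.
  by apply: eq_bigr => i _; rewrite mulrBr.
have pos (Z : option digits -> R) (e : 'I_3) : e != 1 :> nat ->
    (forall i, 0 <= Z i) ->
    (forall d, central d -> Z (Some d) <= Z (Some (set_digit d p e))) ->
    0 <= \sum_i signed_weight i * Z i.
  move=> e1 Z0 Zc; rewrite sum_cells/= addr_ge0//.
    by rewrite mulr_ge0// subr_ge0 ltW.
  under eq_bigr do rewrite -mulrA.
  rewrite -mulr_sumr mulr_ge0 ?(ltW small_weight_gt0)//.
  by apply: (@signed_sum_ge0 (fun d => Z (Some d)) p e).
have Xmono (d : digits) (e e' : 'I_3) : (e <= e')%N ->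
    X (Some (set_digit d p e')) <= X (Some (set_digit d p e)).
  by move=> ee; exact: digit_increment_antitone.
apply/andP; split.
  apply: (pos X ord0) => // [i|d dc]; first by case/andP: (XL i).
  by rewrite -{1}(set_digit_central pp dc); apply: Xmono.
rewrite -subr_ge0 -sumrB; under eq_bigr do rewrite -mulrBr.
apply: (pos (fun i => L i - X i) ord_max) => // [i|d dc].
  by rewrite subr_ge0; case/andP: (XL i).
have -> : L (Some (set_digit d p ord_max)) = L (Some d).
  by rewrite /L !local_coord_digit ffunE eq_sym (negPf pj).
rewrite lerD2l lerN2 -{2}(set_digit_central pp dc); apply: Xmono.
by rewrite inordK.
Qed.

Lemma signed_quasi_copula f : copula_like f ->
  quasi_copula (transform corner side signed_weight f).
Proof.
move=> fC; have [f0 fm _ _] := fC; apply: tame_quasi_copula.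
- exact: leq_ltn_trans (ltn_ord p0).
- exact: (grounded_transform grid_cells).
- exact: (uniform_margins_transform grid_cells signed_weight_marginal).
- exact: tame_increments_signed.
Qed.

Lemma digit_coord_step (e : 'I_3) : e != 1 :> nat ->
  digit_coord e r = digit_coord e (2 * r).
Proof.
case: e => -[|[|[|//]]]//= e3 _; rewrite /digit_coord/=.
  rewrite mulr0 !subr0 divff ?gt_eqF// mulfK ?gt_eqF//.
  by rewrite !clamp_eq1// ler1n.
by have r0 := r_gt0; rewrite !clamp_eq0// pmulr_lle0 ?invr_gt0//; lra.
Qed.

(** Consider the box whose sides are from [r] to [2 * r] along [p0] and [p1] and
    from 0 to 1 along the other axes: all its mass is in the central cubes,
    hence negative. *)
Lemma signed_not_copula f : copula_like f ->
  ~ copula (transform corner side signed_weight f).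
Proof.
move=> [f0 fm _ _] [_].
have r0 := r_gt0; have r3 := r_lt.
pose mid (k : 'I_n) := (k == p0) || (k == p1).
pose a : 'rV[R]_n := \row_k (if mid k then r else 0).
pose b : 'rV[R]_n := \row_k (if mid k then 2 * r else 1).
have ab k : a 0 k <= b 0 k by rewrite !mxE; case: ifP => _; lra.
have sub : closed_box a b `<=` unit_cube.
  move=> x xab k; have := xab k; rewrite !mxE; case: ifP => _ /andP[? ?].
    by apply/andP; split; lra.
  by apply/andP.
move=> /(_ a b ab sub); apply/negP; rewrite -ltNge.
rewrite volume_transform sum_cells (@volume_degenerate _ _ _ _ _ p0); last first.
  rewrite !mxE !local_coord_last /mid eqxx/= /last_coord.
  by rewrite !clamp_eq0// pmulr_lle0 ?invr_gt0; lra.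
rewrite mulr0 add0r (bigID central)/= [X in _ + X]big1 ?addr0; last first.
  move=> d; rewrite /central negb_and => dc.
  have [p pp dp] : exists2 p, mid p & d p != 1 :> nat.
    by case/orP: dc => ?; [exists p0|exists p1] => //; rewrite /mid eqxx ?orbT.
  rewrite (@volume_degenerate _ _ _ _ _ p) ?mulr0//.
  by rewrite !mxE !local_coord_digit pp digit_coord_step.
have vol1 (d : digits) : central d ->
    volume f (localize corner side (Some d) a) (localize corner side (Some d) b) = 1.
  have mid1 : (2 * r - r) / r = 1 by field; rewrite gt_eqF.
  move=> /andP[/eqP d0 /eqP d1]; rewrite volume_grounded//.
    rewrite (fm _ p0).
      rewrite mxE local_coord_digit mxE /mid eqxx/= /digit_coord d0.
      by rewrite mulr1 mid1 !clamp_eq1.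
    move=> k kp; rewrite mxE local_coord_digit mxE /mid (negPf kp)/=.
    case: eqP => [->|_]; rewrite /digit_coord ?d1.
      by rewrite mulr1 mid1 clamp_eq1.
    rewrite clamp_eq1// ler_pdivlMr// mul1r lerBrDl.
    have : r * (d k)%:R <= r * 2 by rewrite ler_pM2l// digit_le2.
    by lra.
  move=> k; rewrite mxE local_coord_digit mxE /mid /digit_coord.
  case: ifP => [/orP[]/eqP->|_]; rewrite ?d0 ?d1.
  - by rewrite mulr1 subrr mul0r clamp_eq0.
  - by rewrite mulr1 subrr mul0r clamp_eq0.
  - by rewrite clamp_eq0// pmulr_lle0 ?invr_gt0// sub0r oppr_le0 mulr_ge0// ltW.
rewrite -oppr_gt0 -sumrN.
have term (d : digits) : central d -> 0 < - (signed_weight (Some d) * volume f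
    (localize corner side (Some d) a) (localize corner side (Some d) b)).
  move=> dc; rewrite vol1//= sign_factor_central// mulr1 mulrN opprK.
  by rewrite mulr_gt0 ?small_weight_gt0 ?invr_gt0.
pose c : digits := [ffun=> inord 1].
have cc : central c by rewrite /central !ffunE inordK.
rewrite (bigD1 c)//= ltr_wpDr ?term// sumr_ge0// => d /andP[dc _].
exact: ltW (term d dc).
Qed.

(** The masses of the nested cubes [[0, r ^ k]^n] at the origin are bounded below
    by the powers of the weight of the first small cube. *)
Lemma zero_in_supp f : copula_like f ->
  transform corner side uniform_weight f = f -> supp f 0.
Proof.
move=> [f0 fm ft _] fE; apply/suppE; split.
  by move=> j; rewrite mxE lexx ler01.
have f_ge0 u : 0 <= f u := tame_ge0 u p0 f0 ft.
have f_pos k : 0 < f (const_mx (r ^+ k)).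
  elim: k => [|k IH].
    by rewrite (fm _ p0) ?mxE ?expr0 ?clamp_eq1// => i _; rewrite mxE.
  pose z : digits := [ffun=> ord0].
  rewrite -fE /transform (bigD1 (Some z))//= ltr_wpDr//.
    by apply: sumr_ge0 => i _; rewrite mulr_ge0// ltW// uniform_weight_gt0.
  rewrite mulr_gt0 ?small_weight_gt0//.
  rewrite (_ : localize _ _ _ _ = const_mx (r ^+ k))//.
  apply/rowP => j; rewrite !mxE local_coord_digit ffunE /digit_coord mulr0 subr0.
  rewrite exprS mulrC mulKf ?gt_eqF// clamp_id// exprn_ge0 ?(ltW r_gt0)//=.
  by rewrite exprn_ile1 ?(ltW r_gt0)//; have := r_gt0; have := r_lt; lra.
case=> e e0 He.
have r01 : 0 < r < 1 by rewrite r_gt0/=; have := r_gt0; have := r_lt; lra.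
have [k ke] := exists_exp_le r01 (divr_gt0 e0 (ltr0n R 2)).
have rk0 : 0 < r ^+ k by rewrite exprn_gt0.
have : volume f 0 (const_mx (r ^+ k)) = 0.
  apply: He => j; rewrite !mxE ?(ltW rk0)//; split=> //; try lra.
  by rewrite exprn_ile1 ?ltW//; case/andP: r01.
rewrite volume_grounded// => [fk0|j]; last by rewrite mxE.
by have := f_pos k; rewrite fk0 ltxx.
Qed.

End Grid.

(** * The proper quasi-copula *)

Theorem theorem12 (R : realType) (n : nat) (hn : (2 <= n)%N)
    (s : R) (hs1 : 1 < s) (hsn : s < n%:R) :
  exists Q : 'rV[R]_n -> R,
    [/\ proper_quasi_copula Q,
        self_similar (supp Q),
        hausdorff_dim (supp Q) = s%:E
      & has_box_dim (supp Q) s%:E].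
Proof.
have [r [r0 r3 rs]] := side_length_exists hs1 hsn.
have n0 : (0 < n)%N := ltnW hn.
pose p0 := Ordinal n0; pose p1 : 'I_n := Ordinal hn.
have p01 : p0 != p1 by [].
have cells := grid_cells p0 r0 r3.
have moran := grid_moran rs.
have wm := @uniform_weight_marginal R n r r0 r3.
have packing := @grid_packing R n r p0 r0 r3.
have w0 (i : option (@digits n)) : 0 < uniform_weight r i :=
  uniform_weight_gt0 r0 r3 i.
have [C CC CE] := transform_fixed_point cells n0 (fun i => ltW (w0 i)) wm.
have E_self : supp C = \bigcup_i (embed (corner r) (side r) i @` supp C).
  rewrite -{1}CE; apply: supp_transform => // i.
  by rewrite gt_eqF.
pose Q := transform (corner r) (side r) (signed_weight r p0 p1) C.
have QE : supp Q = supp C.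
  rewrite [RHS]E_self; apply: supp_transform => // i.
  exact: signed_weight_neq0.
have C0 := zero_in_supp p0 r0 r3 CC CE.
have s0 : 0 <= s by rewrite (le_trans ler01)// ltW.
have upper := upper_regular_self_similar cells moran (@supp_sub_cube _ _ C)
  E_self n0 s0.
have lower := content_positive_self_similar cells moran (@supp_sub_cube _ _ C)
  E_self s0 C0 packing (ltW hsn) (@closed_supp _ _ C) (ltW hs1).
exists Q; rewrite QE; split.
- split; first exact: signed_quasi_copula.
  exact: signed_not_copula.
- exists #|{: option (@digits n)}|.
  exists (fun k => embed (corner r) (side r) (enum_val k)); split.
    move=> k; exists (side r (enum_val k)); split.
      by rewrite (side_gt0 cells) (side_lt1 cells).
    by move=> x y; exact: embed_edist.
  rewrite {1}E_self; apply/seteqP; split=> x [i _ Ex].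
    by exists (enum_rank i) => //; rewrite enum_rankK.
  by exists (enum_val i).
- exact: hausdorff_dim_eq.
- exact: box_dim_eq.
Qed.
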